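(* Let $G$ be a connected soluble Lie group and let $\Lambda\subset G$ be a uniform approximate lattice. Then $\Lambda$ is a Meyer subset of $G$.
   Context: A subset $\Lambda$ of a group $G$ containing the identity is an approximate subgroup if $\Lambda = \Lambda^{-1}$ and there is a finite subset $F \subset G$ with $\Lambda^2 \subset F\Lambda$, where $\Lambda^2 = \{\lambda_1\lambda_2 : \lambda_1,\lambda_2\in\Lambda\}$ and $F\Lambda=\{f\lambda : f\in F,\lambda\in\Lambda\}$. Two subsets $\Lambda,\Xi\subset G$ are commensurable if there is a finite set $F \subset G$ with $\Lambda\subset F\Xi$ and $\Xi\subset F\Lambda$. If $G$ is a topological group, $\Lambda,\Xi\subset G$ are compactly commensurable if there is a compact subset $K\subset G$ with $\Lambda\subset K\Xi$ and $\Xi\subset K\Lambda$. An approximate subgroup $\Lambda$ of a locally compact group $G$ is a uniform approximate lattice if it is discrete and compactly commensurable to $G$. A cut-and-project scheme $(G,H,\Gamma)$ consists of two locally compact groups $G$ and $H$ and a uniform lattice (discrete co-compact subgroup) $\Gamma$ in $G\times H$ such that $\Gamma\cap(\{e_G\}\times H)$ is trivial (i.e. the projection of $\Gamma$ to $G$ is injective) and the projection of $\Gamma$ to $H$ is dense in $H$. Given a cut-and-project scheme $(G,H,\Gamma)$ and a symmetric relatively compact neighbourhood $W_0$ of $e_H$ in $H$, let $\Lambda_{W_0}\subset G$ be the projection to $G$ of $(G\times W_0)\cap\Gamma$. A Meyer subset of $G$ is any approximate subgroup of $G$ that is commensurable to a set $\Lambda_{W_0}$ arising in this way from some cut-and-project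 scheme $(G,H,\Gamma)$ and some such $W_0$. *)

(* Defs.v *)
From HB Require Import structures.
From mathcomp Require Import all_boot all_order all_algebra.
From mathcomp Require Import all_classical all_reals all_analysis.
Import numFieldNormedType.Exports.

Set Implicit Arguments.
Unset Strict Implicit.
Unset Printing Implicit Defensive.

Local Open Scope classical_set_scope.
Local Open Scope quotient_scope.
Local Open Scope group_scope.

HB.mixin Record Topological_Group_isTopologicalGroup G
    & Topological G & Group G := {
  mulg_continuous : continuous (fun x : G * G => x.1 * x.2) ;
  invg_continuous : continuous (fun x : G => x^-1)
}.

#[short(type="topologicalGroupType")]
HB.structure Definition TopologicalGroup :=
  {G of Topological G & Group G & Topological_Group_isTopologicalGroup G}.

Section ProductGroup.
Variables G H : topologicalGroupType.

Let continuous_pair (X Y Z : topologicalType) (f : X -> Y) (g : X -> Z) :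
  continuous f -> continuous g -> continuous (fun x => (f x, g x)).
Proof. by move=> cf cg x; apply: cvg_pair; [exact: cf|exact: cg]. Qed.

Let continuousT_comp (X Y Z : topologicalType) (f : X -> Y) (g : Y -> Z) :
  continuous f -> continuous g -> continuous (fun x => g (f x)).
Proof. by move=> cf cg x; apply: continuous_comp; [exact: cf|exact: cg]. Qed.

Let continuous_fst (X Y : topologicalType) : continuous (@fst X Y).
Proof. by move=> x; exact: cvg_fst. Qed.

Let continuous_snd (X Y : topologicalType) : continuous (@snd X Y).
Proof. by move=> x; exact: cvg_snd. Qed.

Let prod_mulg_continuous :
  continuous (fun x : (G * H) * (G * H) => x.1 * x.2).
Proof.
apply: (@continuous_pair _ _ _ (fun x : (G * H) * (G * H) => x.1.1 * x.2.1)
                               (fun x => x.1.2 * x.2.2)).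
- apply: (@continuousT_comp _ _ _ (fun x : (G * H) * (G * H) => (x.1.1, x.2.1))
    _ _ mulg_continuous).
  by apply: continuous_pair;
    [exact: continuousT_comp (@continuous_fst _ _) (@continuous_fst _ _)
    |exact: continuousT_comp (@continuous_snd _ _) (@continuous_fst _ _)].
- apply: (@continuousT_comp _ _ _ (fun x : (G * H) * (G * H) => (x.1.2, x.2.2))
    _ _ mulg_continuous).
  by apply: continuous_pair;
    [exact: continuousT_comp (@continuous_fst _ _) (@continuous_snd _ _)
    |exact: continuousT_comp (@continuous_snd _ _) (@continuous_snd _ _)].
Qed.

Let prod_invg_continuous : continuous (fun x : G * H => x^-1).
Proof.
apply: (@continuous_pair _ _ _ (fun x : G * H => x.1^-1) (fun x => x.2^-1)).
- exact: continuousT_comp (@continuous_fst _ _) invg_continuous.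
- exact: continuousT_comp (@continuous_snd _ _) invg_continuous.
Qed.

HB.instance Definition _ := Topological_Group_isTopologicalGroup.Build
  (G * H)%type prod_mulg_continuous prod_invg_continuous.

End ProductGroup.

(* Hausdorff is part of the convention for locally compact groups. *)
Definition locally_compact_group (G : topologicalGroupType) :=
  hausdorff_space G /\ locally_compact [set: G].

Section AbstractGroups.
Variable G : groupType.
Implicit Types A B : set G.

Definition set_mulg A B : set G := [set x * y | x in A & y in B].

Definition set_invg A : set G := [set x^-1 | x in A].

Definition subgroup A := group_closed [in A].

Definition generated A : set G := smallest subgroup A.

Fixpoint derived_series (n : nat) : set G :=
  if n is m.+1 then
    generated [set [~ x, y] | x in derived_series m & y in derived_series m]
  else [set: G].

Definition soluble := exists n, derived_series n = [set 1].

Definition approximate_subgroup A :=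
  [/\ A 1, A = set_invg A &
      exists2 F, finite_set F & set_mulg A A `<=` set_mulg F A].

Definition commensurable A B :=
  exists F, [/\ finite_set F, A `<=` set_mulg F B & B `<=` set_mulg F A].

(* Two elements are related when their left cosets coincide; this is an
   equivalence for every A, with quotient G / A when A is a subgroup. *)
Definition lcoset_rel A (x y : G) : bool :=
  `[< set_mulg [set x] A = set_mulg [set y] A >].

Lemma lcoset_rel_refl A : reflexive (lcoset_rel A).
Proof. by move=> x; apply/asboolP. Qed.

Lemma lcoset_rel_sym A : symmetric (lcoset_rel A).
Proof. by move=> x y; apply/asboolP/asboolP. Qed.

Lemma lcoset_rel_trans A : transitive (lcoset_rel A).
Proof. by move=> y x z /asboolP xy /asboolP yz; apply/asboolP; rewrite xy. Qed.

Definition lcoset_equiv A : equiv_rel G :=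
  EquivRel (lcoset_rel A) (@lcoset_rel_refl A) (@lcoset_rel_sym A)
    (@lcoset_rel_trans A).

End AbstractGroups.

Arguments soluble : clear implicits.

Section TopologicalGroups.
Variable G : topologicalGroupType.
Implicit Types A B : set G.

Definition discrete_subset A := forall x, A x -> isolated A x.

Definition compactly_commensurable A B :=
  exists K, [/\ compact K, A `<=` set_mulg K B & B `<=` set_mulg K A].

Definition uniform_approximate_lattice A :=
  [/\ approximate_subgroup A, discrete_subset A &
      compactly_commensurable A [set: G]].

Definition coset_space A := quotient_topology {eq_quot lcoset_equiv A}.

Definition cocompact A := compact [set: coset_space A].

Definition uniform_lattice A :=
  [/\ subgroup A, discrete_subset A & cocompact A].

End TopologicalGroups.

Definition cut_and_project_scheme (G H : topologicalGroupType)
    (Gamma : set (G * H)) :=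
  [/\ locally_compact_group G, locally_compact_group H,
      uniform_lattice Gamma,
      Gamma `&` ([set 1] `*` [set: H]) = [set 1] &
      dense [set p.2 | p in Gamma]].

Definition window (H : topologicalGroupType) (W : set H) :=
  [/\ nbhs 1 W, W = set_invg W & precompact W].

Definition model_set (G H : topologicalGroupType) (Gamma : set (G * H))
    (W : set H) : set G :=
  [set p.1 | p in ([set: G] `*` W) `&` Gamma].

Definition meyer_subset (G : topologicalGroupType) (A : set G) :=
  approximate_subgroup A /\
  exists (H : topologicalGroupType) (Gamma : set (G * H)) (W : set H),
    [/\ cut_and_project_scheme Gamma, window W &
        commensurable A (model_set Gamma W)].

(* f is of class C^k on U. Meant for U open and V finite-dimensional, where
   continuity of every directional derivative amounts to that of the
   differential. *)
Fixpoint class_C (R : realType) (V W : normedModType R) (k : nat)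
    (U : set V) (f : V -> W) : Prop :=
  if k is m.+1 then
    (forall x, U x -> differentiable f x) /\
    (forall v, class_C m U (fun x => 'D_v f x))
  else forall x, U x -> {for x, continuous f}.

Definition smooth_on (R : realType) (V W : normedModType R)
    (U : set V) (f : V -> W) := forall k, class_C k U f.

(* [chart_map] and [chart_inv] are total functions; only their values on the
   domain, resp. the image of the domain, are meaningful. *)
Record chart (R : realType) (M : topologicalType) (n : nat) := Chart {
  chart_dom : set M ;
  chart_map : M -> 'rV[R]_n ;
  chart_inv : 'rV[R]_n -> M
}.

Section Manifolds.
Variables (R : realType) (M : topologicalType) (n : nat).
Implicit Types c d : chart R M n.

Definition chart_cod c : set 'rV[R]_n := chart_map c @` chart_dom c.

Definition is_chart c :=
  [/\ open (chart_dom c), open (chart_cod c),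
      (forall x, chart_dom c x -> chart_inv c (chart_map c x) = x),
      (forall x, chart_dom c x -> {for x, continuous (chart_map c)}) &
      (forall v, chart_cod c v -> {for v, continuous (chart_inv c)})].

Definition smooth_atlas (A : set (chart R M n)) :=
  [/\ (forall c, A c -> is_chart c),
      (forall x, exists2 c, A c & chart_dom c x) &
      (forall c d, A c -> A d ->
         smooth_on [set v | chart_cod c v /\ chart_dom d (chart_inv c v)]
           (fun v => chart_map d (chart_inv c v)))].

End Manifolds.

Definition smooth_mulg (R : realType) (G : topologicalGroupType) (n : nat)
    (A : set (chart R G n)) :=
  forall a b c, A a -> A b -> A c ->
    smooth_on
      [set v : 'rV[R]_n * 'rV[R]_n | [/\ chart_cod a v.1, chart_cod b v.2 &
         chart_dom c (chart_inv a v.1 * chart_inv b v.2)]]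
      (fun v => chart_map c (chart_inv a v.1 * chart_inv b v.2)).

Definition smooth_invg (R : realType) (G : topologicalGroupType) (n : nat)
    (A : set (chart R G n)) :=
  forall a c, A a -> A c ->
    smooth_on
      [set v | chart_cod a v /\ chart_dom c (chart_inv a v)^-1]
      (fun v => chart_map c (chart_inv a v)^-1).

Definition lie_group (R : realType) (G : topologicalGroupType) :=
  [/\ hausdorff_space G, @second_countable G &
      exists n (A : set (chart R G n)),
        [/\ smooth_atlas A, smooth_mulg A & smooth_invg A]].

(* Main.v *)
Require Import Defs.
From HB Require Import structures.
From mathcomp Require Import all_boot all_order all_algebra.
From mathcomp Require Import all_classical all_reals all_analysis.
From mathcomp Require Import ring lra.
Import Order.TTheory GRing.Theory Num.Theory numFieldNormedType.Exports.

(** A soluble group is amenable as a discrete group, so an approximate subgroup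
    Lambda of it carries a finite left-invariant finitely additive measure. By the
    Massicot-Wagner argument there are then subsets B_0, B_1, ... of the group
    generated by Lambda, each commensurable to Lambda, with B_(n+1)^2 in B_n and
    g B_(n+1) g^-1 in B_n for g in Lambda. They form a neighbourhood base at 1 of a
    totally bounded group topology, whose Hausdorff completion H is locally
    compact. Since Lambda is discrete, some B_n meets a neighbourhood of 1 in {1},
    so the graph of the canonical map to H is discrete in G x H; it is cocompact
    because Lambda is, and Lambda is commensurable to the preimage of a
    neighbourhood of 1 in H. *)

Local Open Scope classical_set_scope.

Set Implicit Arguments.
Unset Strict Implicit.
Unset Printing Implicit Defensive.

Local Open Scope ring_scope.
Local Open Scope group_scope.
Local Open Scope quotient_scope.

(** * Amenability of soluble groups *)

(** An invariant mean may well vanish on [Lambda]. It is therefore evaluated on products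
    [set_mulg X E] with a fixed set [E], which gives a positive measure that is additive only near
    the approximate subgroup. Almost stabilisers for this measure have a high power inside a fourth
    power; hence the exponent 4 in the balls. Conjugation by the infinitely many elements of
    [Lambda] is a further obstacle, since only finitely many conjugates may be intersected without
    losing commensurability. [Lambda] is covered by finitely many translates of a small set, the
    conjugates by their centres are intersected, and the leftover small factor is absorbed by spare
    powers. The group generated by [Lambda] may be dense in [G], so that its discreteness cannot be
    used. A ball, however, lies in finitely many translates of the discrete set [Lambda], and such a
    union contains no non-empty set without isolated points. *)

Section LeftTranslates.
Variable G : groupType.
Implicit Types (x y : G) (X Y : set G).

Definition ltranslate x X : set G := [set y | X (x^-1 * y)].

Lemma ltranslate1 X : ltranslate 1 X = X.
Proof. by apply/seteqP; split=> y; rewrite /ltranslate /= invg1 mul1g. Qed.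

Lemma ltranslateM x y X : ltranslate (x * y) X = ltranslate x (ltranslate y X).
Proof. by apply/seteqP; split=> z; rewrite /ltranslate /= invgM mulgA. Qed.

End LeftTranslates.

Section Subgroups.
Variables (G : groupType) (K : set G).
Hypothesis Ksub : subgroup K.

Lemma subgroup1 : K 1.
Proof. by have [] := Ksub; rewrite inE. Qed.

Lemma subgroupV x : K x -> K x^-1.
Proof.
move=> Kx; apply/set_mem; apply: (group_closedV Ksub).
exact: mem_set.
Qed.

Lemma subgroupM x y : K x -> K y -> K (x * y).
Proof.
move=> Kx Ky; apply/set_mem.
by apply: (group_closedM Ksub); exact: mem_set.
Qed.

Lemma subgroupX x n : K x -> K (x ^+ n).
Proof.
move=> Kx; elim: n => [|n IHn]; first by rewrite expg0; exact: subgroup1.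
by rewrite expgSr; exact: subgroupM.
Qed.

End Subgroups.

(** * Finitely additive invariant means *)

Section Means.
Variables (R : realType) (G : groupType).
Implicit Types (nu : set G -> R) (K N X Y : set G) (x y : G).

Definition mean nu :=
  [/\ forall X, (0 <= nu X)%R, nu setT = 1%R &
      forall X Y, X `&` Y = set0 -> nu (X `|` Y) = (nu X + nu Y)%R].

Definition left_invariant K nu :=
  forall x X, K x -> nu (ltranslate x X) = nu X.

Lemma mean_mono nu X Y : mean nu -> X `<=` Y -> (nu X <= nu Y)%R.
Proof.
move=> [nu0 _ nuU] XY; rewrite -(setDUK XY) nuU ?lerDl//.
by rewrite setDE setICA setICr setI0.
Qed.

Lemma mean_le1 nu X : mean nu -> (nu X <= 1)%R.
Proof. by move=> nuM; have [_ <- _] := nuM; exact: mean_mono. Qed.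

Lemma principal_mean x : mean (fun X => (`[< X x >])%:R%R).
Proof.
split=> [X||X Y XY0]; first exact: ler0n.
  by rewrite (asboolT (I : [set: G] x)).
rewrite asbool_or -natrD; congr (_%:R)%R.
case: asboolP => Xx; case: asboolP => Yx //.
by have: (X `&` Y) x by []; rewrite XY0.
Qed.

Definition average nu x (n : nat) X : R :=
  ((\sum_(i < n.+1) nu (ltranslate (x ^+ i)%g X)) / n.+1%:R)%R.

Lemma average_mean nu x n : mean nu -> mean (average nu x n).
Proof.
move=> [nu0 nu1 nuU]; split=> [X||X Y XY0]; rewrite /average.
- by rewrite divr_ge0// sumr_ge0.
- rewrite (eq_bigr (fun=> 1%R)) => [|i _]; last by rewrite -[RHS]nu1.
  by rewrite sumr_const card_ord divff// pnatr_eq0.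
- rewrite -mulrDl -big_split; congr (_ / _)%R; apply: eq_bigr => i _ /=.
  rewrite -nuU//; apply/seteqP; split=> // y [Xy Yy].
  by have: (X `&` Y) ((x ^+ i)%g^-1 * y) by []; rewrite XY0.
Qed.

(** Translation by [x] shifts the sum by one index, so it telescopes to a difference of two numbers
    in [0, 1]. *)
Lemma average_close nu x n X : mean nu ->
  (`|average nu x n (ltranslate x X) - average nu x n X| <= n.+1%:R^-1)%R.
Proof.
move=> nuM; rewrite /average -mulrBl normrM [X in (_ * X)%R]ger0_norm//.
rewrite ler_piMl ?invr_ge0//; have [nu0 _ _] := nuM.
under eq_bigr do rewrite -ltranslateM -expgSr.
rewrite -sumrB -(big_mkord xpredT (fun i =>
  nu (ltranslate (x ^+ i.+1)%g X) - nu (ltranslate (x ^+ i)%g X))%R).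
rewrite telescope_sumr//.
by rewrite ler_norml; have := mean_le1 (ltranslate (x ^+ n.+1)%g X) nuM;
  have := mean_le1 (ltranslate (x ^+ 0)%g X) nuM;
  have := nu0 (ltranslate (x ^+ n.+1)%g X);
  have := nu0 (ltranslate (x ^+ 0)%g X); lra.
Qed.


Definition normalized_by N K := forall x y, K x -> N y -> N (x * y * x^-1).

Lemma average_invariant nu K N x n : subgroup K -> normalized_by N K -> K x ->
  left_invariant N nu -> left_invariant N (average nu x n).
Proof.
move=> Ksub NK Kx nuN y X Ny; congr (_ / _)%R; apply: eq_bigr => i _.
rewrite -ltranslateM -(mulgVK (x ^+ i) (x ^+ i * y)) ltranslateM nuN//.
by apply: NK => //; exact: subgroupX.
Qed.

(** Modulo [N], under which [nu] is invariant, [y] commutes with each power of [x]. Averaging over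
    [x] thus does not spoil what was gained for [y], and elements can be treated one at a time. *)
Lemma average_almost_invariant nu K N x y n (e : R) : subgroup K ->
  (forall u v, K u -> K v -> N [~ u, v]) -> K x -> K y ->
  left_invariant N nu ->
  (forall X, `|nu (ltranslate y X) - nu X| <= e)%R ->
  forall X, (`|average nu x n (ltranslate y X) - average nu x n X| <= e)%R.
Proof.
move=> Ksub NK Kx Ky nuN nuy X.
rewrite /average -mulrBl -sumrB normrM [X in (_ * X)%R]ger0_norm ?invr_ge0//.
rewrite ler_pdivrMr ?ltr0n// mulrC mulr_natl.
apply: (le_trans (ler_norm_sum _ _ _)).
rewrite -[X in (_ *+ X)%R]card_ord -sumr_const; apply: ler_sum => i _.
have Kxi : K (x ^+ i) by exact: subgroupX.
rewrite -ltranslateM commgCV ltranslateM nuN; last first.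
  by apply: NK; exact: subgroupV.
by rewrite ltranslateM; exact: nuy.
Qed.

Lemma almost_invariant_mean nu K N (s : seq G) n : subgroup K ->
  normalized_by N K -> (forall u v, K u -> K v -> N [~ u, v]) ->
  (forall x, x \in s -> K x) -> mean nu -> left_invariant N nu ->
  exists nu', [/\ mean nu', left_invariant N nu' &
    forall x X, x \in s -> (`|nu' (ltranslate x X) - nu' X| <= n.+1%:R^-1)%R].
Proof.
move=> Ksub NK KN + nuM nuN; elim: s => [_|x s IHs sK]; first by exists nu.
have Kx : K x by apply: sK; rewrite mem_head.
have [|nu' [nu'M nu'N nu's]] := IHs.
  by move=> y ys; apply: sK; rewrite inE ys orbT.
exists (average nu' x n); split; first exact: average_mean.
  exact: (average_invariant _ Ksub NK Kx nu'N).
move=> y X; rewrite inE => /predU1P[->|ys]; first exact: average_close.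
have Ky : K y by apply: sK; rewrite inE ys orbT.
apply: (average_almost_invariant _ Ksub KN Kx Ky nu'N) => Y; exact: nu's.
Qed.

Lemma ultra_compact_cvg (I : Type) (T : topologicalType) (U : set_system I)
    (A : set T) (f : I -> T) : UltraFilter U -> compact A ->
  (forall i, A (f i)) -> exists l : T, f @ U --> l.
Proof.
move=> UU cA fA; have UA : U (f @^-1` A) by apply: filterS filterT => i _; exact: fA.
have [l [_ fl]] := cA (f @ U) _ UA.
exists l => B lB; have [//|UB] := in_ultra_setVsetC (f @^-1` B) UU.
by have [y []] := fl (~` B) B UB lB.
Qed.

(* An ultralimit of almost K-invariant means is K-invariant. *)
Lemma extend_invariant_mean K N : subgroup K -> normalized_by N K ->
  (forall u v, K u -> K v -> N [~ u, v]) ->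
  (exists2 nu, mean nu & left_invariant N nu) ->
  exists2 nu, mean nu & left_invariant K nu.
Proof.
move=> Ksub NK KN [nu nuM nuN].
pose good (i : seq G * nat) nu' := mean nu' /\
  forall x X, x \in i.1 -> K x ->
    (`|nu' (ltranslate x X) - nu' X| <= i.2.+1%:R^-1)%R.
have /choice[f fP] i : exists nu', good i nu'.
  have [|nu' [nu'M _ nu's]] :=
      @almost_invariant_mean nu K N [seq x <- i.1 | `[< K x >]] i.2
        Ksub NK KN _ nuM nuN.
    by move=> x; rewrite mem_filter => /andP[/asboolP].
  exists nu'; split=> // x X xi Kx; apply: nu's.
  by rewrite mem_filter xi andbT; apply/asboolP.
(* The tails of the directed set of pairs (finite list, precision). Along an ultrafilter containing
   them, small errors on finite lists become exact invariance under every element of [K]. *)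
pose F : set_system (seq G * nat) := filter_from [set: seq G * nat]
  (fun i => [set j : seq G * nat | {subset i.1 <= j.1} /\ (i.2 <= j.2)%N]).
have FF : ProperFilter F.
  apply: filter_from_proper; last by move=> i _; exists i; split.
  apply: filter_from_filter; first by exists ([::], 0%N).
  move=> i j _ _; exists (i.1 ++ j.1, maxn i.2 j.2) => //= k [/= ijk ijn].
  split; split.
  - by move=> x xi; apply: ijk; rewrite mem_cat xi.
  - exact: leq_trans (leq_maxl _ _) ijn.
  - by move=> x xi; apply: ijk; rewrite mem_cat xi orbT.
  - exact: leq_trans (leq_maxr _ _) ijn.
have [U [UU FU]] := ultraFilterLemma FF.
have fle1 i X : (0 <= f i X <= 1)%R.
  have [fM _] := fP i; have [f0 _ _] := fM.
  by rewrite f0 mean_le1.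
have /choice[L LP] X : exists l : R, (fun i => f i X) @ U --> l.
  apply: ultra_compact_cvg (@segment_compact R 0%R 1%R) _ => i.
  by rewrite /= in_itv /= fle1.
have FP (i0 : seq G * nat) (P : set (seq G * nat)) :
    (forall i : seq G * nat, {subset i0.1 <= i.1} -> (i0.2 <= i.2)%N -> P i) ->
    U P.
  by move=> h; apply: FU; exists i0 => // i [] /=; exact: h.
exists L; first split=> [X||X Y XY0].
- by apply: cvgr_to_ge (LP X) _; near=> i; have /andP[] := fle1 i X.
- apply: (cvg_unique _ (LP setT)) => //.
  apply: cvg_near_cst; near=> i; have [[_ -> _] _] := fP i.
  by [].
- apply: (cvg_unique _ (LP (X `|` Y))) => //.
  rewrite (_ : (fun i => _) = fun i => (f i X + f i Y)%R); last first.
    by apply/funext => i; have [[_ _ fiU] _] := fP i; exact: fiU.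
  exact: cvgD.
move=> x X Kx; apply/eqP; rewrite -subr_eq0 -normr_le0; apply/ler_addgt0Pl => e e0.
rewrite addr0.
have fd : (fun i => `|f i (ltranslate x X) - f i X|%R) @ U -->
    `|L (ltranslate x X) - L X|%R.
  by apply: cvg_norm; apply: cvgB.
apply: cvgr_to_le fd _.
have [n ne] : exists n, (n.+1%:R^-1 <= e)%R.
  exists (Num.truncn e^-1); rewrite invf_ple ?posrE//.
  by rewrite ltW// truncnS_gt.
apply: (FP ([:: x], n)) => i /(_ _ (mem_head _ _)) xi ni.
have [_ /(_ x X xi Kx) h] := fP i.
apply: (le_trans h); apply: le_trans ne.
by rewrite lef_pV2 ?posrE// ler_nat.
Unshelve. all: by end_near. Qed.

End Means.

Lemma derived_series_subgroup (G : groupType) n : subgroup (@derived_series G n).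
Proof.
case: n => [|n] /=; first by split=> [|x y _ _]; rewrite in_setT.
split=> [|x y]; first by apply/mem_set => A [/subgroup1].
move=> /set_mem Dx /set_mem Dy; apply/mem_set => A AS.
have [As _] := AS.
by apply: subgroupM => //; [exact: Dx|apply: subgroupV => //; exact: Dy].
Qed.

Lemma derived_series_comm (G : groupType) n (x y : G) :
  derived_series n x -> derived_series n y -> derived_series n.+1 [~ x, y].
Proof. by move=> Dx Dy; apply: sub_gen_smallest; exists x => //; exists y. Qed.

Lemma derived_series_decr (G : groupType) n :
  @derived_series G n.+1 `<=` derived_series n.
Proof.
apply: smallest_sub; first exact: derived_series_subgroup.
move=> _ [x Dx [y Dy <-]]; have S := @derived_series_subgroup G n.
rewrite /commg /conjg.
by do ?[apply: subgroupM => //]; exact: subgroupV.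
Qed.

Lemma soluble_invariant_mean (R : realType) (G : groupType) : soluble G ->
  exists2 nu : set G -> R, mean nu & left_invariant [set: G] nu.
Proof.
move=> [n Dn].
(* The induction climbs from the trivial term of the derived series, where the point mass at 1 is
   invariant, to the whole group. *)
suff h k : (k <= n)%N ->
    exists2 nu : set G -> R, mean nu & left_invariant (derived_series (n - k)) nu.
  by have := h n (leqnn n); rewrite subnn.
elim: k => [_|k IHk kn].
  rewrite subn0 Dn; exists (fun X : set G => `[< X 1%g >]%:R%R).
    exact: principal_mean.
  by move=> x X ->; rewrite ltranslate1.
have nk : (n - k = (n - k.+1).+1)%N by rewrite subnSK.
have := IHk (ltnW kn); rewrite nk; apply: extend_invariant_mean.
- exact: derived_series_subgroup.
- move=> x y Dx Dy; rewrite [x * y]commgCV -mulgA mulgK.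
  apply: (subgroupM (@derived_series_subgroup G (n - k.+1).+1)) => //.
  have S := @derived_series_subgroup G (n - k.+1).
  apply: derived_series_comm; first exact: subgroupV.
  by apply: subgroupV => //; exact: derived_series_decr.
- exact: derived_series_comm.
Qed.

(** * Approximate subgroups *)

Section SetProducts.
Variable G : groupType.
Implicit Types (A B C F : set G) (x y : G).

Fixpoint set_expg A k : set G :=
  if k is j.+1 then set_mulg A (set_expg A j) else [set 1].

Definition inv_closed A := forall x, A x -> A x^-1.

Definition covered A B := exists2 F, finite_set F & A `<=` set_mulg F B.

Lemma mem_set_mulg A B x y : A x -> B y -> set_mulg A B (x * y).
Proof. by move=> Ax By; exists x => //; exists y. Qed.

Lemma set_mulgA A B C : set_mulg A (set_mulg B C) = set_mulg (set_mulg A B) C.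
Proof.
apply/seteqP; split=> u.
  move=> [x Ax [_ [y By [z Cz <-]] <-]]; rewrite mulgA.
  by do ?apply: mem_set_mulg.
move=> [_ [x Ax [y By <-]] [z Cz <-]]; rewrite -mulgA.
by do ?apply: mem_set_mulg.
Qed.

Lemma set_mulgSS A A' B B' :
  A `<=` A' -> B `<=` B' -> set_mulg A B `<=` set_mulg A' B'.
Proof.
by move=> AA' BB' _ [x Ax [y By <-]]; apply: mem_set_mulg; [exact: AA'|exact: BB'].
Qed.

Lemma set_mulg_1l A : set_mulg [set 1] A = A.
Proof.
apply/seteqP; split=> [_ [y -> [x Ax <-]]|x Ax]; first by rewrite mul1g.
by rewrite -(mul1g x); exact: mem_set_mulg.
Qed.

Lemma set_mulg_1r A : set_mulg A [set 1] = A.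
Proof.
apply/seteqP; split=> [_ [x Ax [y -> <-]]|x Ax]; first by rewrite mulg1.
by rewrite -(mulg1 x); exact: mem_set_mulg.
Qed.

Lemma set_expg1 A : set_expg A 1 = A.
Proof. exact: set_mulg_1r. Qed.

Lemma set_expg2 A : set_expg A 2 = set_mulg A A.
Proof. by rewrite /= set_mulg_1r. Qed.

Lemma set_expgD A m n :
  set_expg A (m + n) = set_mulg (set_expg A m) (set_expg A n).
Proof.
elim: m => [|m IHm]; first by rewrite set_mulg_1l.
by rewrite addSn /= IHm set_mulgA.
Qed.

Lemma mem_set_expgD A m n x y :
  set_expg A m x -> set_expg A n y -> set_expg A (m + n) (x * y).
Proof. by rewrite set_expgD; exact: mem_set_mulg. Qed.

Lemma set_expgM A m n : set_expg (set_expg A m) n = set_expg A (m * n).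
Proof.
elim: n => [|n IHn]; first by rewrite muln0.
by rewrite mulnS set_expgD /= IHn.
Qed.

Lemma set_expgS A B n : A `<=` B -> set_expg A n `<=` set_expg B n.
Proof. by move=> AB; elim: n => //= n IHn; exact: set_mulgSS. Qed.

Lemma set_expg_1 A n : A 1 -> set_expg A n 1.
Proof.
move=> A1; elim: n => //= n IHn.
by rewrite -[1]mul1g; exact: mem_set_mulg.
Qed.

Lemma set_expg_le A m n : A 1 -> (m <= n)%N -> set_expg A m `<=` set_expg A n.
Proof.
move=> A1 mn x Ax; rewrite -(subnKC mn) -[x]mulg1.
by apply: mem_set_expgD => //; exact: set_expg_1.
Qed.

Lemma set_expg_inv A n : inv_closed A -> inv_closed (set_expg A n).
Proof.
move=> AV; elim: n => [x ->|n IHn]; first by rewrite invg1.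
move=> _ [y Ay [z Az <-]]; rewrite invgM -addn1.
apply: mem_set_expgD; first exact: IHn.
by rewrite set_expg1; exact: AV.
Qed.

Lemma covered_sub A B : A `<=` B -> covered A B.
Proof. by move=> AB; exists [set 1]; rewrite ?set_mulg_1l//; exact: finite_set1. Qed.

Lemma finite_set_mulg A B : finite_set A -> finite_set B ->
  finite_set (set_mulg A B).
Proof. by move=> fA fB; exact: finite_image2. Qed.

Lemma covered_trans B A C : covered A B -> covered B C -> covered A C.
Proof.
move=> [F fF AFB] [F' fF' BFC]; exists (set_mulg F F').
  exact: finite_set_mulg.
by apply: (subset_trans AFB); rewrite -set_mulgA; exact: set_mulgSS.
Qed.

Lemma covered_mulgr A B C : covered A B -> covered (set_mulg A C) (set_mulg B C).
Proof.
by move=> [F fF AFB]; exists F => //; rewrite set_mulgA; exact: set_mulgSS.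
Qed.

Lemma covered_expg A n : A 1 -> covered (set_mulg A A) A -> covered (set_expg A n) A.
Proof.
move=> A1 AA; elim: n => [|n IHn].
  by apply: covered_sub => _ ->.
rewrite -addn1 set_expgD set_expg1.
by apply: covered_trans AA; exact: covered_mulgr.
Qed.

(* Finite colourings express covers symmetrically, which makes them stable under
   intersection. *)
Definition colourable A (P : set G) := exists (T : finType) (c : G -> T),
  forall x y, A x -> A y -> c x = c y -> P (x^-1 * y).

(** Colour [x] by the centre [f] of a translate of [B] that contains it: for equal colours
    [x^-1 * y] is [(f^-1 * x)^-1 * (f^-1 * y)]. *)
Lemma covered_colourable A B : inv_closed B -> covered A B ->
  colourable A (set_mulg B B).
Proof.
move=> BV [F fF AFB].
have [s Fs] : exists s : seq G, F = [set` s] by apply/finite_seqP.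
have /choice[c cP] x : exists f, A x -> F f /\ B (f^-1 * x).
  have [/AFB[f Ff [b Bb <-]]|nAx] := pselect (A x); last by exists 1.
  by exists f => _; rewrite mulKg.
exists 'I_(size s).+1, (fun x => inord (index (c x) s)) => x y Ax Ay.
have [Fx Bx] := cP _ Ax; have [Fy By] := cP _ Ay.
have iP z : F z -> (index z s < (size s).+1)%N.
  by rewrite Fs ltnS => _; exact: index_size.
move=> /(congr1 val); rewrite /= !inordK ?iP// => /(congr1 (nth 1 s)).
rewrite !nth_index; [|by rewrite Fs in Fy|by rewrite Fs in Fx] => cxy.
rewrite -[x^-1](mulgK (c x)) -mulgA; apply: mem_set_mulg; last by rewrite cxy.
by rewrite -[X in _ * X]invgK -invgM; exact: BV.
Qed.

Lemma colourableI A P Q : colourable A P -> colourable A Q -> colourable A (P `&` Q).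
Proof.
move=> [T [c cP]] [T' [d dQ]]; exists (T * T')%type, (fun x => (c x, d x)).
by move=> x y Ax Ay [cxy dxy]; split; [exact: cP|exact: dQ].
Qed.

Lemma colourable_bigcap A (I : eqType) (s : seq I) (P : I -> set G) :
  (forall i, i \in s -> colourable A (P i)) ->
  colourable A [set x | forall i, i \in s -> P i x].
Proof.
elim: s => [_|i s IHs sP]; first by exists unit, (fun=> tt).
have [|T [c cP]] := colourableI (sP i (mem_head _ _)) (IHs _).
  by move=> j js; apply: sP; rewrite inE js orbT.
exists T, c => x y Ax Ay /(cP _ _ Ax Ay)[Pi Ps] j.
by rewrite inE => /predU1P[->//|]; exact: Ps.
Qed.

(** One point of [A] represents each colour that occurs. That the centres lie in [A] matters later:
    they must stay in a bounded power of the generators. *)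
Lemma colourable_covered A P : colourable A P ->
  exists F, [/\ finite_set F, F `<=` A & A `<=` set_mulg F P].
Proof.
move=> [T [c cP]].
pose r t := xget 1 (A `&` (c @^-1` [set t])).
have rP x : A x -> A (r (c x)) /\ c (r (c x)) = c x.
  by move=> Ax; rewrite /r; case: xgetP => [y _ //|/(_ x)]; case.
exists (A `&` (r @` setT)); split.
  exact/finite_setIr/finite_image/finite_finset.
  by move=> x [].
move=> x Ax; have [Ar cr] := rP x Ax.
rewrite -[x](mulVKg (r (c x))); apply: mem_set_mulg; last exact: cP.
by split=> //; exists (c x).
Qed.

End SetProducts.

(** * Approximate subgroups of amenable groups *)

Section MassicotWagner.
Variables (R : realType) (G : groupType).
Implicit Types (A B X Y Z : set G) (x y g : G).

Lemma ltranslateE g X : ltranslate g X = set_mulg [set g] X.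
Proof.
apply/seteqP; split=> [x Xx|_ [y -> [x Xx <-]]]; last first.
  by rewrite /ltranslate /= mulKg.
by rewrite -[x](mulVKg g); exact: mem_set_mulg.
Qed.

Lemma ltranslate_mulg g X Y :
  ltranslate g (set_mulg X Y) = set_mulg (ltranslate g X) Y.
Proof. by rewrite !ltranslateE set_mulgA. Qed.

Lemma ltranslateI g X Y : ltranslate g (X `&` Y) = ltranslate g X `&` ltranslate g Y.
Proof. by []. Qed.

Lemma set_mulgU X Y Z : set_mulg (X `|` Y) Z = set_mulg X Z `|` set_mulg Y Z.
Proof.
apply/seteqP; split=> [_ [x [Xx|Yx] [y Zy <-]]|_ [|] [x Xx [y Zy <-]]].
- by left; exact: mem_set_mulg.
- by right; exact: mem_set_mulg.
- by apply: mem_set_mulg => //; left.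
- by apply: mem_set_mulg => //; right.
Qed.

Lemma set_mulg_cons g (s : seq G) B :
  set_mulg [set` g :: s] B = ltranslate g B `|` set_mulg [set` s] B.
Proof.
rewrite ltranslateE -set_mulgU; congr set_mulg; apply/seteqP; split=> x /=.
  by rewrite inE => /predU1P[]; [left|right].
by rewrite inE => -[->|->]; rewrite ?eqxx ?orbT.
Qed.

(** Additivity is confined to subsets of [set_mulg A A], which contains every translate and product
    that is cut into pieces below; elsewhere subadditivity suffices. *)
Record local_measure A (m : set G -> R) : Prop := LocalMeasure {
  local_measure01 : forall X, (0 <= m X <= 1)%R ;
  local_measure0 : m set0 = 0%R ;
  local_measureS : forall X Y, X `<=` Y -> (m X <= m Y)%R ;
  local_measureU : forall X Y, (m (X `|` Y) <= m X + m Y)%R ;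
  local_measureT : forall g X, m (ltranslate g X) = m X ;
  local_measureD : forall X Y, X `<=` set_mulg A A ->
    m X = (m (X `&` Y) + m (X `\` Y))%R ;
  local_measure_gt0 : (0 < m A)%R
}.

Lemma local_measure_cover (m : set G -> R) B Z (s : seq G) (r : R) :
  m set0 = 0%R -> (forall X Y, (m (X `|` Y) <= m X + m Y)%R) ->
  (forall x, x \in s -> m (Z `&` ltranslate x B) <= r)%R ->
  (m (Z `&` set_mulg [set` s] B) <= (size s)%:R * r)%R.
Proof.
move=> m00 mU; elim: s => [_|x s IHs xr].
  rewrite mul0r (_ : _ `&` _ = set0) ?m00//.
  by apply/seteqP; split=> // z [_ [y]]; rewrite /= in_nil.
rewrite set_mulg_cons setIUr (le_trans (mU _ _))//.
rewrite /= -natr1 mulrDl mul1r addrC lerD ?xr ?mem_head// IHs// => y ys.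
by rewrite xr// inE ys orbT.
Qed.

(* The measure of X is the mean of X E for E maximal among the sets whose right
   translates by A^4 are disjoint: then products x e with x in A^2 are unique,
   whence additivity inside A^2, while A^4 E is everything. *)
Lemma amenable_local_measure A (nu : set G -> R) : mean nu ->
  left_invariant setT nu -> A 1 -> inv_closed A -> covered (set_mulg A A) A ->
  exists m, local_measure A m.
Proof.
move=> nuM nuG A1 AV AA; have [nu0 nu1 nuU] := nuM.
pose P (E : set G) := forall e e', E e -> E e' ->
  set_expg A 4 (e' * e^-1) -> e = e'.
have [C totC|E [PE Emax]] := @Zorn_bigcup G P.
  move=> CP e e' [X CX Xe] [Y CY Ye'].
  have [XY|YX] := CP _ _ CX CY.
    by apply: (totC _ CY) => //; exact: XY.
  by apply: (totC _ CX) => //; exact: YX.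
have A4E : set_mulg (set_expg A 4) E = setT.
  apply/seteqP; split=> // g _; apply: contrapT => nAEg.
  have nEg e : E e -> ~ set_expg A 4 (g * e^-1).
    by move=> Ee Ag; apply: nAEg; rewrite -[g](mulgVK e); exact: mem_set_mulg.
  apply: (Emax (g |` E)).
    split; first exact: subsetUr.
    move=> /(_ g (or_introl erefl)) Eg.
    by apply: (nEg g Eg); rewrite mulgV; exact: set_expg_1.
  move=> e e' [->|Ee] [->|Ee']//.
  - move=> /(set_expg_inv AV); rewrite invgF => Ag; exact: contra_notP (nEg _ Ee') _.
  - by move=> Ag; case: (nEg _ Ee).
  - exact: PE.
pose m X := nu (set_mulg X E).
have mU X Y : (m (X `|` Y) <= m X + m Y)%R.
  rewrite /m set_mulgU -(setDUK (@subsetUl _ (set_mulg X E) (set_mulg Y E))).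
  rewrite nuU; last by rewrite setDE setICA setICr setI0.
  by rewrite lerD2l mean_mono// => z [[]].
have m00 : m set0 = 0%R.
  rewrite /m (_ : set_mulg set0 E = set0); last by apply/seteqP; split=> // z [].
  by have := nuU _ _ (setI0 set0); rewrite setU0; lra.
have mS X Y : X `<=` Y -> (m X <= m Y)%R.
  move=> XY; apply: (mean_mono nuM); exact: set_mulgSS.
have m01 X : (0 <= m X <= 1)%R by rewrite nu0 (mean_le1 _ nuM).
have mT g X : m (ltranslate g X) = m X.
  by rewrite /m -ltranslate_mulg nuG.
exists m; split=> //.
  move=> X Y XA; rewrite -{1}(setUIDK X Y) {1}/m set_mulgU nuU//.
  apply/seteqP; split=> // z [[x [Xx Yx] [e Ee <-]] [x' [Xx' nYx'] [e' Ee']]] xe.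
  have ee' : e = e'.
    apply: PE => //; rewrite -[e'](mulKg x') xe mulgA mulgK.
    apply: (@mem_set_expgD _ _ 2 2); last by rewrite set_expg2; exact: XA.
    by apply: set_expg_inv; rewrite // set_expg2; exact: XA.
  by apply: nYx'; move: xe; rewrite ee' => /mulIg ->.
(* If [m A] were 0, finitely many null translates of [A] would cover [set_expg A 4], whose product
   with [E] is the whole group and has mean 1. *)
rewrite lt_neqAle (andP (m01 _)).1 andbT eq_sym; apply/eqP => mA0.
have [F /finite_seqP[s ->] AF] := covered_expg 4 A1 AA.
have := local_measure_cover (B := A) (Z := setT) (s := s) (r := 0%R) m00 mU.
rewrite mulr0 setTI; apply/not_implyP; split.
  by move=> x xs; rewrite setTI mT mA0.
apply/negP; rewrite -ltNge; apply: (@lt_le_trans _ _ 1%R) => //.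
by rewrite -nu1 -A4E; apply: (mean_mono nuM); exact: set_mulgSS.
Qed.

(** An approximate stabiliser of [B], known in additive combinatorics as a set of popular
    differences. *)
Definition big_overlap (m : set G -> R) B (sigma : R) : set G :=
  [set g | (sigma <= m (ltranslate g B `&` B))%R].

Section LocalMeasure.
Variables (A : set G) (m : set G -> R).
Hypotheses (A1 : A 1) (AV : inv_closed A) (mA : local_measure A m).

Lemma big_overlap_inv B sigma : inv_closed (big_overlap m B sigma).
Proof.
move=> g; rewrite /big_overlap /= => /le_trans; apply.
rewrite -(local_measureT mA g^-1) ltranslateI -ltranslateM mulVg ltranslate1.
by rewrite setIC.
Qed.

Lemma big_overlap_sub B sigma : B `<=` A -> (0 < sigma)%R ->
  big_overlap m B sigma `<=` set_mulg A A.
Proof.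
move=> BA sigma0 g gB.
have [b [Bb Bb']] : ltranslate g B `&` B !=set0.
  apply/set0P/eqP => gB0; move: gB; rewrite /big_overlap /= gB0 (local_measure0 mA).
  by rewrite leNgt sigma0.
rewrite -[g](mulVKg b) -[X in b * X]invgK invgM invgK.
by apply: mem_set_mulg; [exact: BA|apply: AV; exact: BA].
Qed.

(** Otherwise a greedy choice gives arbitrarily many translates of [B] by elements of [A] with small
    pairwise overlaps, and their union becomes too large. *)
Lemma big_overlap_covers B : B `<=` A -> (0 < m B)%R ->
  exists2 sigma, (0 < sigma <= m B)%R & covered A (big_overlap m B sigma).
Proof.
move=> BA B0.
(* With [N.+1] translates the total is at least 3, and the overlaps cost at most [N.+1 ^ 2] times
   [sigma], hence at most 1: the union would have measure at least 2, above the bound 1. *)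
have [N NB] : exists N, (3 <= N.+1%:R * m B)%R.
  exists (Num.truncn (3 / m B)); rewrite -ler_pdivrMr//.
  by rewrite ltW// truncnS_gt.
pose sigma : R := Num.min (m B) (N.+1%:R ^- 2)%R.
have sigma0 : (0 < sigma)%R by rewrite lt_min B0 invr_gt0 exprn_gt0.
exists sigma; first by rewrite sigma0 ge_min lexx.
apply: contrapT => ncov.
have grow n : (n <= N.+1)%N -> exists s : seq G, [/\ size s = n,
    forall x, x \in s -> A x &
    (n%:R * m B - (n * N.+1)%:R * sigma <= m (set_mulg [set` s] B))%R].
  elim: n => [_|n IHn nN].
    exists [::]; split=> //; rewrite !mul0r subrr.
    by have /andP[] := local_measure01 mA (set_mulg [set` [::]] B).
  have [s [sn sA sB]] := IHn (ltnW nN).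
  have [g Ag gs] : exists2 g, A g &
      forall x, x \in s -> (m (ltranslate g B `&` ltranslate x B) <= sigma)%R.
    apply: contrapT => nog; apply: ncov; exists [set` s]; first exact: finite_seq.
    move=> g Ag; apply: contrapT => ng; apply: nog; exists g => // x xs.
    rewrite leNgt; apply/negP => gx; apply: ng.
    rewrite -[g](mulVKg x); apply: mem_set_mulg => //.
    rewrite /big_overlap /= -(local_measureT mA x) ltranslateI -ltranslateM mulVKg.
    exact: ltW.
  exists (g :: s); split; first by rewrite /= sn.
    by move=> x; rewrite inE => /predU1P[->|/sA].
  rewrite set_mulg_cons.
  set Y := set_mulg [set` s] B in sB *.
  have YA : Y `<=` set_mulg A A by apply: set_mulgSS => // x /sA.
  have gA : ltranslate g B `<=` set_mulg A A.
    by rewrite ltranslateE; apply: set_mulgSS => // x ->.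
  have -> : (m (ltranslate g B `|` Y) = m Y + m (ltranslate g B `\` Y))%R.
    rewrite (local_measureD mA Y); last by rewrite subUset.
    by rewrite setIUl setIid (setUidr (@subIsetr _ _ _)) setDUl setDv setU0.
  have := local_measureD mA Y gA; rewrite (local_measureT mA g B).
  have := local_measure_cover (local_measure0 mA) (local_measureU mA) gs.
  rewrite -/Y sn => h1 h2.
  have h3 : (n%:R * sigma <= N.+1%:R * sigma)%R.
    by rewrite ler_wpM2r ?(ltW sigma0)// ler_nat ltnW.
  rewrite -natr1 mulSn natrD; lra.
have [s [_ _]] := grow _ (leqnn _).
apply/negP; rewrite -ltNge; apply: (le_lt_trans (andP (local_measure01 mA _)).2).
have : ((N.+1 * N.+1)%:R * sigma <= 1)%R.
  apply: (@le_trans _ _ ((N.+1 * N.+1)%:R * N.+1%:R ^- 2)%R).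
    by rewrite ler_wpM2l// ge_min lexx orbT.
  by rewrite natrM -expr2 divff// expf_neq0.
by move=> h; lra.
Qed.

(* Otherwise m (B A) would decrease geometrically along a sequence of B, although
   it is at least m A. *)
Lemma almost_minimal_product (e : R) : (0 < e < 1)%R ->
  exists B (sigma : R), [/\ B `<=` A, (0 < sigma <= m B)%R,
    covered A (big_overlap m B sigma) &
    forall B', B' `<=` A -> (sigma <= m B')%R ->
      ((1 - e) * m (set_mulg B A) <= m (set_mulg B' A))%R].
Proof.
move=> /andP[e0 e1]; apply: contrapT => nB.
have decr n : exists B, [/\ B `<=` A, (0 < m B)%R &
    (m (set_mulg B A) <= (1 - e) ^+ n)%R].
  elim: n => [|n [B [BA B0 Bn]]].
    exists A; split=> //; first exact: local_measure_gt0.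
    by have /andP[] := local_measure01 mA (set_mulg A A).
  have [sigma sigmaB cov] := big_overlap_covers BA B0.
  apply: contrapT => nB'; apply: nB; exists B, sigma; split=> // B' B'A sB'.
  rewrite leNgt; apply/negP => lt; apply: nB'; exists B'; split=> //.
    by apply: lt_le_trans sB'; have /andP[] := sigmaB.
  by rewrite (le_trans (ltW lt))// exprS ler_pM2l// subr_gt0.
have [n nA] : exists n, ((1 - e) ^+ n < m A)%R.
  have : (`|1 - e| < 1)%R by rewrite ger0_norm ?subr_ge0 ?(ltW e1)// ltrBlDr ltrDl.
  move=> /cvg_expr /cvgr0_norm_lt /(_ _ (local_measure_gt0 mA)).
  by move=> [n _ /(_ n (leqnn n))] /(le_lt_trans (ler_norm _)); exists n.
have [B [BA B0 Bn]] := decr n.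
have [b Bb] : B !=set0.
  by apply/set0P/eqP => B0'; move: B0; rewrite B0' (local_measure0 mA) ltxx.
have : (m A <= m (set_mulg B A))%R.
  rewrite -(local_measureT mA b) ltranslateE; apply: (local_measureS mA).
  by apply: set_mulgSS => // _ ->.
by rewrite leNgt (le_lt_trans Bn nA).
Qed.

(* Left translation by an element of S moves B A by at most a proportion e of its
   measure, so that B A still meets its translate by a product of k elements. *)
Lemma large_power_in_fourth_power k : exists S, [/\ S 1, inv_closed S,
  S `<=` set_mulg A A, set_expg S k `<=` set_expg A 4 & covered A S].
Proof.
(* [k.+2] makes [k%:R * e] less than 1 and also keeps [e] below 1 when [k] is 0. *)
pose e : R := (k.+2%:R^-1)%R.
have e0 : (0 < e)%R by rewrite invr_gt0.
have [|B [sigma [BA sB cov Bmin]]] := @almost_minimal_product e.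
  by rewrite e0 invf_lt1// ltr1n.
have /andP[sigma0 sigmaB] := sB.
have B0 : (0 < m B)%R by exact: lt_le_trans sigmaB.
set S := big_overlap m B sigma in cov.
exists S; split=> //.
- by rewrite /S /big_overlap /= ltranslate1 setIid.
- exact: big_overlap_inv.
- exact: big_overlap_sub.
pose BAm := m (set_mulg B A).
have BAA : set_mulg B A `<=` set_mulg A A by exact: set_mulgSS.
(* For [g] in [S] the set [ltranslate g B]&[B] is itself a competitor in the minimality of [B], and
   its product with [A] lies in both [set_mulg B A] and its translate. *)
have step g : S g ->
    (m (set_mulg B A `\` ltranslate g (set_mulg B A)) <= e * BAm)%R.
  move=> Sg; have := local_measureD mA (ltranslate g (set_mulg B A)) BAA.
  have : ((1 - e) * BAm <=
      m (set_mulg B A `&` ltranslate g (set_mulg B A)))%R.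
    apply: (@le_trans _ _ (m (set_mulg (ltranslate g B `&` B) A))).
      by apply: Bmin => // x [_ /BA].
    apply: (local_measureS mA); rewrite ltranslate_mulg setIC.
    by move=> _ [x [gx Bx] [a Aa <-]]; split; exact: mem_set_mulg.
  rewrite -/BAm; lra.
have steps j g : set_expg S j g ->
    (m (set_mulg B A `\` ltranslate g (set_mulg B A)) <= j%:R * (e * BAm))%R.
  elim: j g => [_ ->|j IHj _ [x Sx [y Sy <-]]].
    by rewrite ltranslate1 setDv (local_measure0 mA) mul0r.
  rewrite -natr1 mulrDl mul1r addrC; apply: le_trans (lerD (step _ Sx) (IHj _ Sy)).
  rewrite -[X in (_ + X)%R](local_measureT mA x).
  apply: le_trans (local_measureU mA _ _); apply: (local_measureS mA).
  rewrite ltranslateM => z [BAz nz].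
  have [xz|nxz] := pselect (ltranslate x (set_mulg B A) z); last by left.
  by right.
move=> g /steps Sg.
have BAm0 : (0 < BAm)%R.
  apply: (lt_le_trans B0); apply: (local_measureS mA) => b Bb.
  by rewrite -[b]mulg1; exact: mem_set_mulg.
have ke : (k%:R * e < 1)%R.
  by rewrite /e ltr_pdivrMr// mul1r ltr_nat.
have [z [[b Bb [a Aa ba]] gz]] :
    set_mulg B A `&` ltranslate g (set_mulg B A) !=set0.
  apply/set0P/eqP => I0; move: Sg.
  have := local_measureD mA (ltranslate g (set_mulg B A)) BAA.
  rewrite I0 (local_measure0 mA) add0r => <-; rewrite -/BAm mulrA.
  by rewrite leNgt gtr_pMl// ke.
have [b' Bb' [a' Aa' ba']] := gz.
have -> : g = b * a * (b' * a')^-1 by rewrite ba ba' invgM invgK mulVKg.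
apply: (@mem_set_expgD _ _ 2 2).
  by rewrite set_expg2; apply: mem_set_mulg => //; exact: BA.
apply: set_expg_inv => //; rewrite set_expg2.
by apply: mem_set_mulg => //; exact: BA.
Qed.

End LocalMeasure.

End MassicotWagner.

(* The balls play the role of a neighbourhood base at 1 of a group topology on the
   group generated by [fgen], for which the powers of [fgen] are totally bounded. *)
Record filtration (G : groupType) := Filtration {
  fgen : set G ;
  fball : nat -> set G ;
  fgen1 : fgen 1 ;
  fgenV : inv_closed fgen ;
  fball1 : forall n, fball n 1 ;
  fballV : forall n, inv_closed (fball n) ;
  fballM : forall n x y, fball n.+1 x -> fball n.+1 y -> fball n (x * y) ;
  fballJ : forall n g x, fgen g -> fball n.+1 x -> fball n (g * x * g^-1) ;
  fball_sub : fball 0 `<=` set_expg fgen 4 ;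
  fball_cover : forall k n, exists F, [/\ finite_set F, F `<=` set_expg fgen k &
    set_expg fgen k `<=` set_mulg F (fball n)]
}.

(** * Construction of a filtration from an approximate subgroup *)

Section FiltrationExists.
Variables (R : realType) (G : groupType) (nu : set G -> R).
Hypotheses (nuM : mean nu) (nuG : left_invariant setT nu).
Variable L : set G.
Hypotheses (L1 : L 1) (LV : inv_closed L) (LL : covered (set_mulg L L) L).

Definition commensurable_part (S : set G) :=
  [/\ S 1, inv_closed S, exists k, S `<=` set_expg L k & covered L S].

(** The conjugate of [L] by [f^-1] lies in a power of [L], which finitely many translates of [S]
    cover; conjugating this cover back gives the claim. *)
Lemma covered_conj f (S : set G) :
  commensurable_part S -> (exists k, set_expg L k f) ->
  covered L [set x | S (f^-1 * x * f)].
Proof.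
move=> [S1 SV _ LS] [k Lf].
have : covered [set f^-1 * x * f | x in L] S.
  apply: covered_trans LS; apply: covered_trans (covered_expg (k + 1 + k) L1 LL).
  apply: covered_sub => _ [x Lx <-]; apply: mem_set_expgD => //.
  by apply: mem_set_expgD; rewrite ?set_expg1//; exact: set_expg_inv.
move=> [F fF LF]; exists [set f * x * f^-1 | x in F]; first exact: finite_image.
move=> x Lx; have [y Fy [s Ss ys]] := LF _ (imageP _ Lx).
exists (f * y * f^-1); first by exists y.
exists (f * s * f^-1); first by rewrite /= !mulgA mulVg mul1g mulgVK.
by rewrite !mulgA mulgVK -[f * y * s]mulgA ys !mulgA mulgV mul1g mulgK.
Qed.

Lemma commensurable_part_step S : commensurable_part S ->
  exists T, [/\ commensurable_part T, set_expg T 8 `<=` set_expg S 4 &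
    forall g x, L g -> set_expg T 4 x -> set_expg S 4 (g * x * g^-1)].
Proof.
move=> Spart; have [S1 SV [k Sk] LS] := Spart.
have SS : covered (set_mulg S S) S.
  apply: covered_trans LS; apply: covered_trans (covered_expg (k + k) L1 LL).
  by apply: covered_sub; rewrite set_expgD; exact: set_mulgSS.
have [m mS] := amenable_local_measure nuM nuG S1 SV SS.
(* [T] will lie in [set_mulg P P], so [set_expg T 8] needs 16 factors of [P]. Conjugation by [g],
   with [g^-1 = f * p] and [p] in [set_mulg P P], needs only 2 + 8 + 2. *)
have [P [P1 PV PS P16 SP]] := large_power_in_fourth_power S1 SV mS 16.
have LP : covered L P by exact: covered_trans SP.
have Ppart : commensurable_part P.
  split=> //; exists (k + k)%N; apply: (subset_trans PS).
  by rewrite set_expgD; exact: set_mulgSS.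
have [F [fF FL LFP]] := colourable_covered (covered_colourable PV LP).
have [s Fs] : exists s : seq G, F = [set` s] by apply/finite_seqP.
pose C f := [set x | P (f^-1 * x * f)].
have CV f : inv_closed (C f).
  by move=> x /PV; rewrite /C /= !invgM invgK mulgA.
(* Covers survive intersection only as colourings, which turn [C f] into [set_mulg (C f) (C f)]. The
   extra index 1 puts [T] inside [set_mulg P P]. *)
pose T := [set x | forall f, f \in 1 :: s -> set_mulg (C f) (C f) x].
have TP x : T x -> set_expg P 2 x.
  move=> /(_ 1 (mem_head _ _)); rewrite set_expg2; apply: set_mulgSS => y;
  by rewrite /C /= invg1 mulg1 mul1g.
have LT : covered L T.
  have [|F' [fF' _ LF']] := @colourable_covered _ L T; last by exists F'.
  apply: colourable_bigcap => f fs; apply: covered_colourable => //.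
  apply: covered_conj => //; move: fs; rewrite inE => /predU1P[->|fs].
    by exists 0%N.
  by exists 1%N; rewrite set_expg1; apply: FL; rewrite Fs.
exists T; split.
- split=> //.
  + move=> f _; rewrite -[1]mulg1.
    by apply: mem_set_mulg; rewrite /C /= mulg1 mulVg.
  + move=> x Tx f /Tx [y Cy [z Cz <-]]; rewrite invgM.
    by apply: mem_set_mulg; exact: CV.
  + exists (k + k + (k + k))%N => x /TP; rewrite set_expg2.
    move=> [y /PS[y1 Sy1 [y2 Sy2 <-]] [z /PS[z1 Sz1 [z2 Sz2 <-]] <-]].
    by do !apply: mem_set_expgD; exact: Sk.
- have /subset_trans : set_expg T 8 `<=` set_expg (set_expg P 2) 8.
    by apply: set_expgS => x; exact: TP.
  by apply; rewrite set_expgM; exact: P16.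
move=> g x Lg Tx.
have [f Ff [p PPp fp]] := LFP _ (LV Lg).
have -> : g * x * g^-1 = p^-1 * (f^-1 * x * f) * p.
  by rewrite -[g^-1]fp -[g]invgK -fp invgM !mulgA.
apply: P16; rewrite -[16%N]/(2 + 12 + 2)%N.
have P2 : set_expg P 2 p by rewrite set_expg2.
apply: mem_set_expgD => //; apply: mem_set_expgD; first exact: set_expg_inv.
apply: (@set_expg_le _ _ 8) => //.
have conjT n y : set_expg T n y -> set_expg P (2 * n) (f^-1 * y * f).
  elim: n y => [_ ->|n IHn _ [y Ty [z Tz <-]]]; first by rewrite mulg1 mulVg.
  rewrite mulnS; have -> : f^-1 * (y * z) * f = (f^-1 * y * f) * (f^-1 * z * f).
    by rewrite !mulgA mulgK.
  apply: mem_set_expgD; last exact: IHn.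
  have [|u Cu [v Cv <-]] := Ty f.
    by rewrite inE; move: Ff; rewrite Fs /= => ->; rewrite orbT.
  rewrite set_expg2; have -> : f^-1 * (u * v) * f = (f^-1 * u * f) * (f^-1 * v * f).
    by rewrite !mulgA mulgK.
  exact: mem_set_mulg.
exact: (conjT 4).
Qed.

Lemma filtration_exists : exists Phi : filtration G, fgen Phi = L.
Proof.
have /choice[f fP] (S : set G) : exists T, commensurable_part S ->
    [/\ commensurable_part T, set_expg T 8 `<=` set_expg S 4 &
    forall g x, L g -> set_expg T 4 x -> set_expg S 4 (g * x * g^-1)].
  have [/commensurable_part_step[T ?]|nS] := pselect (commensurable_part S).
    by exists T.
  by exists S.
(* With fourth powers as balls, the inclusion of [set_expg T 8] in [set_expg S 4] is exactly the
   product axiom [fballM]. *)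
pose S n := iter n f L; pose B n := set_expg (S n) 4.
have SP n : commensurable_part (S n).
  elim: n => [|n IHn]; last by have [] := fP _ IHn.
  by split=> //; [exists 1%N; rewrite set_expg1|exact: covered_sub].
have B1 n : B n 1 by have [] := SP n => *; exact: set_expg_1.
have BV n : inv_closed (B n) by have [] := SP n => *; exact: set_expg_inv.
have BM n x y : B n.+1 x -> B n.+1 y -> B n (x * y).
  have [_ h _] := fP _ (SP n).
  by move=> Bx By; apply: h; exact: (@mem_set_expgD _ _ 4 4).
have BJ n g x : L g -> B n.+1 x -> B n (g * x * g^-1).
  by have [_ _ h] := fP _ (SP n); exact: h.
have B0 : B 0%N `<=` set_expg L 4 by [].
have Bcov k n : exists F, [/\ finite_set F, F `<=` set_expg L k &
    set_expg L k `<=` set_mulg F (B n)].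
  have [S1 SV _ LS] := SP n.
  have /(covered_colourable SV)/colourable_covered[F [fF FL LF]] :
      covered (set_expg L k) (S n).
    by apply: covered_trans LS; exact: covered_expg.
  exists F; split=> //; apply: (subset_trans LF); apply: set_mulgSS => //.
  by rewrite -set_expg2; exact: set_expg_le.
by exists (Filtration L1 LV B1 BV BM BJ B0 Bcov).
Qed.

End FiltrationExists.

(** * The limit group of a filtration *)

Section Hyperfilter.

Definition hyperfilter : set_system nat :=
  sval (cid (ultraFilterLemma eventually_filter)).

Lemma hyperfilter_ultra : UltraFilter hyperfilter.
Proof. by rewrite /hyperfilter; case: cid => F []. Qed.

Lemma hyperfilter_eventually : eventually `<=` hyperfilter.
Proof. by rewrite /hyperfilter; case: cid => F []. Qed.

Lemma ultra_finite_union (I J : Type) (U : set_system I) (F : set J)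
    (P : J -> set I) : UltraFilter U -> finite_set F ->
  U (\bigcup_(j in F) P j) -> exists2 j, F j & U (P j).
Proof.
move=> UU fF UP; apply: contrapT => nP.
have UnP j : F j -> U (~` P j).
  by move=> Fj; have [Pj|//] := in_ultra_setVsetC (P j) UU; case: nP; exists j.
have [s Fs] : exists s : seq {classic J}, F = [set` s] by apply/finite_seqP.
move: UP UnP; rewrite Fs; elim: s {Fs nP} => [|j s IHs] UP UnP.
  by have [i [j]] := filter_ex UP.
apply: IHs => [|k ks]; last by apply: UnP; rewrite /= inE ks orbT.
apply: filterS2 UP (UnP j (mem_head _ _)) => i [k /=].
by rewrite inE => /predU1P[-> //|ks Pi _]; exists k.
Qed.

End Hyperfilter.

#[local] Existing Instance hyperfilter_ultra.

Section LimitGroup.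
Variables (G : groupType) (Phi : filtration G).
Notation gen := (fgen Phi).
Notation ball := (fball Phi).

Definition filtered_subgroup : set G := [set g | exists k, set_expg gen k g].

Lemma filtered_subgroup1 : filtered_subgroup 1.
Proof. by exists 0%N. Qed.

Lemma filtered_subgroupM g h :
  filtered_subgroup g -> filtered_subgroup h -> filtered_subgroup (g * h).
Proof. by move=> [k gk] [l hl]; exists (k + l)%N; exact: mem_set_expgD. Qed.

Lemma filtered_subgroupV g : filtered_subgroup g -> filtered_subgroup g^-1.
Proof. by move=> [k gk]; exists k; apply: set_expg_inv => //; exact: fgenV. Qed.

Lemma fball_le m n : (m <= n)%N -> ball n `<=` ball m.
Proof.
move=> /subnK <-; elim: (n - m)%N => // k IHk x bx; apply: IHk.
by rewrite -[x]mulg1; apply: fballM => //; exact: fball1.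
Qed.

Lemma fball_gen n : ball n `<=` set_expg gen 4.
Proof. exact: subset_trans (fball_le (leq0n n)) (@fball_sub _ Phi). Qed.

Lemma fballJX k n g x : set_expg gen k g -> ball (k + n) x -> ball n (g * x * g^-1).
Proof.
elim: k n g x => [|k IHk] n g x; first by move=> ->; rewrite invg1 mulg1 mul1g.
move=> [y gy [z gz <-]]; rewrite addSnnS => bx.
have -> : y * z * x * (y * z)^-1 = y * (z * x * z^-1) * y^-1.
  by rewrite invgM !mulgA.
by apply: fballJ => //; exact: IHk.
Qed.

(** The exponent is uniform in [i]: conjugation by the whole sequence then costs a fixed number of
    ball indices, which makes the infinitesimal sequences a normal subgroup. *)
Definition bounded_sequence (s : nat -> G) : bool :=
  `[< exists k, forall i, set_expg gen k (s i) >].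

Definition bseq := {s : nat -> G | bounded_sequence s}.

Definition bseq1 : bseq.
Proof. by exists (fun=> 1); apply/asboolP; exists 0%N. Defined.

Definition bseqV (s : bseq) : bseq.
Proof.
exists (fun i => (sval s i)^-1); apply/asboolP.
have /asboolP[k sk] := svalP s; exists k => i.
by apply: set_expg_inv => //; exact: fgenV.
Defined.

Definition bseqM (s t : bseq) : bseq.
Proof.
exists (fun i => sval s i * sval t i); apply/asboolP.
have /asboolP[k sk] := svalP s; have /asboolP[l tl] := svalP t.
by exists (k + l)%N => i; exact: mem_set_expgD.
Defined.

(* Outside the filtered subgroup, the junk value is the constant sequence 1. *)
Definition bseqC (g : G) : bseq.
Proof.
exists (fun=> if `[< filtered_subgroup g >] then g else 1); apply/asboolP.
by case: asboolP => [[k gk]|_]; [exists k|exists 0%N].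
Defined.

Definition near_ball n (s : nat -> G) : Prop := hyperfilter [set i | ball n (s i)].

Definition infinitely_close (s t : bseq) : Prop :=
  forall n, near_ball n (fun i => (sval s i)^-1 * sval t i).

Lemma near_ball1 n s : (forall i, s i = 1) -> near_ball n s.
Proof.
by move=> s1; apply: filterS filterT => i _ /=; rewrite s1; exact: fball1.
Qed.

Lemma near_ballV n s : near_ball n s -> near_ball n (fun i => (s i)^-1).
Proof. by apply: filterS => i; exact: fballV. Qed.

Lemma near_ballM n s t :
  near_ball n.+1 s -> near_ball n.+1 t -> near_ball n (fun i => s i * t i).
Proof. by move=> sn tn; apply: filterS2 sn tn => i; exact: fballM. Qed.

Lemma near_ballJ (s : bseq) n : exists m, forall t, near_ball m t ->
  near_ball n (fun i => sval s i * t i * (sval s i)^-1).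
Proof.
have /asboolP[k sk] := svalP s; exists (k + n)%N => t.
by apply: filterS => i; exact: fballJX.
Qed.

Lemma near_ball_ext n s t : s =1 t -> near_ball n s -> near_ball n t.
Proof. by move=> /funext ->. Qed.

Lemma infinitely_close_refl s : infinitely_close s s.
Proof. by move=> n; apply: near_ball1 => i; rewrite mulVg. Qed.

Lemma infinitely_close_sym s t : infinitely_close s t -> infinitely_close t s.
Proof.
move=> st n; apply: near_ball_ext (near_ballV (st n)) => i.
by rewrite invgM invgK.
Qed.

Lemma infinitely_close_trans t s u :
  infinitely_close s t -> infinitely_close t u -> infinitely_close s u.
Proof.
move=> st tu n; apply: near_ball_ext (near_ballM (st _) (tu _)) => i.
by rewrite mulgA mulgK.
Qed.

Lemma infinitely_closeV s t :
  infinitely_close s t -> infinitely_close (bseqV s) (bseqV t).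
Proof.
move=> st n; have [m mP] := near_ballJ s n.
apply: near_ball_ext (mP _ (infinitely_close_sym st m)) => i /=.
by rewrite invgK mulgA mulgK.
Qed.

Lemma infinitely_closeM s t s' t' : infinitely_close s t -> infinitely_close s' t' ->
  infinitely_close (bseqM s s') (bseqM t t').
Proof.
move=> st st' n; have [m mP] := near_ballJ (bseqV s') n.+1.
apply: near_ball_ext (near_ballM (mP _ (st m)) (st' n.+1)) => i /=.
by rewrite invgM invgK !mulgA mulgK.
Qed.

Definition close_rel (s t : bseq) : bool := `[< infinitely_close s t >].

Lemma close_rel_refl : reflexive close_rel.
Proof. by move=> s; apply/asboolP; exact: infinitely_close_refl. Qed.

Lemma close_rel_sym : symmetric close_rel.
Proof. by move=> s t; apply/asboolP/asboolP; exact: infinitely_close_sym. Qed.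

Lemma close_rel_trans : transitive close_rel.
Proof.
move=> t s u /asboolP st /asboolP tu; apply/asboolP.
exact: infinitely_close_trans tu.
Qed.

Definition close_equiv : equiv_rel bseq :=
  EquivRel close_rel close_rel_refl close_rel_sym close_rel_trans.

(* Bounded sequences modulo infinitesimal ones along an ultrafilter: this is the
   Hausdorff completion, and completeness is automatic. *)
Definition limit_group : Type := {eq_quot close_equiv}.

HB.instance Definition _ := Choice.on limit_group.

Definition lim_of (s : bseq) : limit_group := \pi_({eq_quot close_equiv}) s.
Definition lim_repr (h : limit_group) : bseq := repr (h : {eq_quot close_equiv}).

Lemma lim_reprK h : lim_of (lim_repr h) = h.
Proof. exact: reprK. Qed.

Lemma lim_ofP s t : lim_of s = lim_of t <-> infinitely_close s t.
Proof.
split=> [/eqmodP /asboolP //|st]; apply/eqmodP; exact/asboolP.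
Qed.

Lemma lim_repr_close s : infinitely_close (lim_repr (lim_of s)) s.
Proof. by apply/lim_ofP; rewrite lim_reprK. Qed.

Definition lim_one : limit_group := lim_of bseq1.
Definition lim_inv (g : limit_group) : limit_group := lim_of (bseqV (lim_repr g)).
Definition lim_mul (g h : limit_group) : limit_group :=
  lim_of (bseqM (lim_repr g) (lim_repr h)).

Lemma lim_ofM' s t : lim_mul (lim_of s) (lim_of t) = lim_of (bseqM s t).
Proof. by apply/lim_ofP; apply: infinitely_closeM; exact: lim_repr_close. Qed.

Lemma lim_ofV' s : lim_inv (lim_of s) = lim_of (bseqV s).
Proof. by apply/lim_ofP; apply: infinitely_closeV; exact: lim_repr_close. Qed.

Lemma lim_of_ext s t : sval s =1 sval t -> lim_of s = lim_of t.
Proof.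
by move=> st; apply/lim_ofP => n; apply: near_ball1 => i; rewrite st mulVg.
Qed.

Lemma lim_ind (P : limit_group -> Prop) : (forall s, P (lim_of s)) -> forall h, P h.
Proof. by move=> Ps h; rewrite -(lim_reprK h). Qed.

Lemma lim_mulA : associative lim_mul.
Proof.
elim/lim_ind => s; elim/lim_ind => t; elim/lim_ind => u; rewrite !lim_ofM'.
by apply: lim_of_ext => i /=; rewrite mulgA.
Qed.

Lemma lim_mul1 : left_id lim_one lim_mul.
Proof.
elim/lim_ind => s; rewrite lim_ofM'.
by apply: lim_of_ext => i /=; rewrite mul1g.
Qed.

Lemma lim_mulr1 : right_id lim_one lim_mul.
Proof.
elim/lim_ind => s; rewrite lim_ofM'.
by apply: lim_of_ext => i /=; rewrite mulg1.
Qed.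

Lemma lim_mulV : left_inverse lim_one lim_inv lim_mul.
Proof.
elim/lim_ind => s; rewrite lim_ofV' lim_ofM'.
by apply: lim_of_ext => i /=; rewrite mulVg.
Qed.

Lemma lim_mulrV : right_inverse lim_one lim_inv lim_mul.
Proof.
elim/lim_ind => s; rewrite lim_ofV' lim_ofM'.
by apply: lim_of_ext => i /=; rewrite mulgV.
Qed.

HB.instance Definition _ :=
  isGroup.Build limit_group lim_mulA lim_mul1 lim_mulr1 lim_mulV lim_mulrV.

Lemma lim_ofM s t : lim_of s * lim_of t = lim_of (bseqM s t).
Proof. exact: lim_ofM'. Qed.

Lemma lim_ofV s : (lim_of s)^-1 = lim_of (bseqV s).
Proof. exact: lim_ofV'. Qed.

(** * Topology of the limit group *)

Definition lim_ball n : set limit_group :=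
  [set h | exists2 s, lim_of s = h & near_ball n (sval s)].

Lemma lim_ball1 n : lim_ball n 1.
Proof. by exists bseq1 => //; exact: near_ball1. Qed.

Lemma lim_ballV n : inv_closed (lim_ball n).
Proof.
by move=> _ [s <- sn]; exists (bseqV s); [rewrite lim_ofV|exact: near_ballV].
Qed.

Lemma lim_ballM n g h : lim_ball n.+1 g -> lim_ball n.+1 h -> lim_ball n (g * h).
Proof.
move=> [s <- sn] [t <- tn]; exists (bseqM s t); first by rewrite lim_ofM.
exact: near_ballM.
Qed.

Lemma lim_ball_le m n : (m <= n)%N -> lim_ball n `<=` lim_ball m.
Proof.
move=> mn _ [s <- sn]; exists s => //.
by apply: filterS sn => i; exact: fball_le.
Qed.

Lemma lim_ballJ h n : exists m, forall u, lim_ball m u -> lim_ball n (h * u * h^-1).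
Proof.
elim/lim_ind: h => s; have [m mP] := near_ballJ s n.
exists m => _ [t <- tm]; exists (bseqM (bseqM s t) (bseqV s)); last exact: mP.
by rewrite lim_ofV !lim_ofM.
Qed.

(** [lim_ball] asks for one good representative; passing to another multiplies by an infinitesimal
    sequence and costs one index. *)
Lemma lim_ball_near n s : lim_ball n.+1 (lim_of s) -> near_ball n (sval s).
Proof.
move=> [t /lim_ofP ts tn].
by apply: near_ball_ext (near_ballM tn (ts n.+1)) => i; rewrite mulVKg.
Qed.

Lemma lim_ball_sep h : (forall n, lim_ball n h) -> h = 1.
Proof.
elim/lim_ind: h => s sn; apply/esym/lim_ofP => n.
by apply: near_ball_ext (lim_ball_near (sn n.+1)) => i /=; rewrite invg1 mul1g.
Qed.

HB.instance Definition _ := hasNbhs.Build limit_group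
  (fun h => [set P | exists n, forall u, lim_ball n u -> P (h * u)]).

Lemma lim_nbhs_filter (h : limit_group) : ProperFilter (nbhs h).
Proof.
split=> [[n h0]|]; first exact: (h0 _ (lim_ball1 n)).
split.
- by exists 0%N.
- move=> P Q [m Pm] [n Qn]; exists (maxn m n) => u un; split.
    by apply: Pm; exact: (lim_ball_le (leq_maxl _ _) un).
  by apply: Qn; exact: (lim_ball_le (leq_maxr _ _) un).
- by move=> P Q PQ [n Pn]; exists n => u /Pn; exact: PQ.
Qed.

Lemma lim_nbhs_singleton (h : limit_group) P : nbhs h P -> P h.
Proof. by move=> [n Pn]; rewrite -[h]mulg1; exact: (Pn _ (lim_ball1 n)). Qed.

Lemma lim_nbhs_nbhs (h : limit_group) P : nbhs h P -> nbhs h (nbhs^~ P).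
Proof.
move=> [n Pn]; exists n.+1 => u un; exists n.+1 => v vn.
by rewrite -mulgA; apply: Pn; exact: lim_ballM.
Qed.

HB.instance Definition _ := Nbhs_isNbhsTopological.Build limit_group
  lim_nbhs_filter lim_nbhs_singleton lim_nbhs_nbhs.

Lemma lim_mulg_continuous :
  continuous (fun x : limit_group * limit_group => x.1 * x.2).
Proof.
move=> [g h] P /= [n Pn].
have [m mP] := lim_ballJ h^-1 n.+1; rewrite invgK in mP.
exists ([set g * u | u in lim_ball m], [set h * u | u in lim_ball n.+1]).
  by split; [exists m|exists n.+1] => u un; exists u.
move=> [_ _] /= [[u um <-] [v vn <-]].
have -> : g * u * (h * v) = g * h * (h^-1 * u * h * v) by rewrite !mulgA mulgK.
by apply: Pn; apply: lim_ballM => //; exact: mP.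
Qed.

Lemma lim_invg_continuous : continuous (fun x : limit_group => x^-1).
Proof.
move=> g P [n Pn]; have [m mP] := lim_ballJ g n; exists m => u um /=.
have -> : (g * u)^-1 = g^-1 * (g * u^-1 * g^-1) by rewrite invgM !mulgA mulVg mul1g.
by apply: Pn; apply: mP; exact: lim_ballV.
Qed.

HB.instance Definition _ := Topological_Group_isTopologicalGroup.Build limit_group
  lim_mulg_continuous lim_invg_continuous.

Lemma nbhs_lim_ball h n : nbhs h [set h * u | u in lim_ball n].
Proof. by exists n => u un; exists u. Qed.

Lemma limit_group_hausdorff : hausdorff_space limit_group.
Proof.
move=> g h gh; suff gh1 : g^-1 * h = 1 by rewrite -[h](mulVKg g) gh1 mulg1.
apply: lim_ball_sep => n.
have [_ [[u un <-] [v vn huv]]] :=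
  gh _ _ (nbhs_lim_ball g n.+1) (nbhs_lim_ball h n.+1).
have -> : g^-1 * h = u * v^-1.
  by rewrite -[h](mulgK v) huv -mulgA mulKg.
by apply: lim_ballM => //; exact: lim_ballV.
Qed.

(** * The canonical map, its dense image and compact balls *)

Definition embed (g : G) : limit_group := lim_of (bseqC g).

Lemma bseqCE g i : filtered_subgroup g -> sval (bseqC g) i = g.
Proof. by move=> gg; rewrite /= asboolT. Qed.

Lemma embedM g h : filtered_subgroup g -> filtered_subgroup h ->
  embed (g * h) = embed g * embed h.
Proof.
move=> gg hh; rewrite /embed lim_ofM; apply: lim_of_ext => i.
rewrite [RHS](_ : _ = sval (bseqC g) i * sval (bseqC h) i)//.
by rewrite !bseqCE//; exact: filtered_subgroupM.
Qed.

Lemma embedV g : filtered_subgroup g -> embed g^-1 = (embed g)^-1.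
Proof.
move=> gg; rewrite /embed lim_ofV; apply: lim_of_ext => i.
rewrite [RHS](_ : _ = (sval (bseqC g) i)^-1)//.
by rewrite !bseqCE//; exact: filtered_subgroupV.
Qed.

Lemma embed1 : embed 1 = 1.
Proof. by apply: lim_of_ext => i; rewrite bseqCE//; exact: filtered_subgroup1. Qed.

Lemma embed_ball n g : ball n g -> lim_ball n (embed g).
Proof.
move=> gn; exists (bseqC g) => //; apply: filterS filterT => i _ /=.
by rewrite asboolT//; exists 4%N; exact: fball_gen gn.
Qed.

Lemma ball_embed n g : filtered_subgroup g -> lim_ball n.+1 (embed g) -> ball n g.
Proof.
move=> gg /lim_ball_near /filter_ex[i] /=.
by rewrite asboolT.
Qed.

(** The values of [s] fall into finitely many translates of a ball, and the ultrafilter selects one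
    translate that holds almost all of them. *)
Lemma lim_cover k n : exists F, [/\ finite_set F, F `<=` set_expg gen k &
  forall s, hyperfilter [set i | set_expg gen k (sval s i)] ->
    exists2 f, F f & lim_ball n ((embed f)^-1 * lim_of s)].
Proof.
have [F [fF Fk kF]] := @fball_cover _ Phi k n.
exists F; split=> // s sk.
have [|f Ff fs] := @ultra_finite_union _ _ _ F
  (fun f => [set i | ball n (f^-1 * sval s i)]) _ fF.
  apply: filterS sk => i /kF[f Ff [b bn fb]]; exists f => //=.
  by rewrite -fb mulKg.
exists f => //; exists (bseqM (bseqV (bseqC f)) s).
  by rewrite -lim_ofM -lim_ofV.
by apply: filterS fs => i /=; rewrite asboolT//; exists k; exact: Fk.
Qed.

Lemma embed_dense h n :
  exists2 g, filtered_subgroup g & lim_ball n ((embed g)^-1 * h).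
Proof.
elim/lim_ind: h => s; have /asboolP[k sk] := svalP s.
have [F [_ Fk FP]] := lim_cover k n.
have [|f Ff fs] := FP s; first by apply: filterS filterT => i _; exact: sk.
by exists f => //; exists k; exact: Fk.
Qed.

Lemma closure_lim_ball n : closure (lim_ball n.+1) `<=` lim_ball n.
Proof.
move=> h /(_ _ (nbhs_lim_ball h n.+1))[x [xn [u un uh]]].
by rewrite -[h](mulgK u) uh; apply: lim_ballM => //; exact: lim_ballV.
Qed.

(* The ultrafilter is covered by translates of arbitrarily small balls by elements
   f_n of gen^4, and the class of the sequence f is its limit. *)
Lemma compact_closure_lim_ball : compact (closure (lim_ball 1)).
Proof.
rewrite compact_ultra => U UU Ucl.
(* Elements of [lim_ball 0] have representatives almost everywhere in [set_expg gen 4], so all the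
   [f n] can be taken in that one power and form a bounded sequence. *)
have U0 : U (lim_ball 0) by apply: filterS Ucl; exact: closure_lim_ball.
have /choice[f fP] n : exists f, set_expg gen 4 f /\
    U [set h | lim_ball n ((embed f)^-1 * h)].
  have [F [fF F4 FP]] := lim_cover 4 n.
  have [|f Ff fU] := @ultra_finite_union _ _ _ F
      (fun f => [set h | lim_ball n ((embed f)^-1 * h)]) UU fF.
    apply: filterS U0 => _ [s <- s0]; have [|f Ff fs] := FP s; last by exists f.
    by apply: filterS s0 => i; exact: fball_gen.
  by exists f; split=> //; exact: F4.
have fg n : filtered_subgroup (f n) by exists 4%N; have [] := fP n.
have fbd : bounded_sequence f by apply/asboolP; exists 4%N => i; have [] := fP i.
pose s : bseq := exist _ f fbd.
have Us : U --> lim_of s.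
  (* Three indices are spent: on the product with [h], on [ball_embed], and on comparing [f j] with
     [f n.+3] through a common point [h']. *)
  move=> P [n Pn]; have [_] := fP n.+3; apply: filterS => h hn.
  rewrite -[h](mulVKg (lim_of s)); apply: Pn.
  have -> : (lim_of s)^-1 * h =
      ((lim_of s)^-1 * embed (f n.+3)) * ((embed (f n.+3))^-1 * h).
    by rewrite mulgA mulgK.
  apply: lim_ballM; last exact: (@lim_ball_le n.+1 n.+3 (leq_addl 2 _) _ hn).
  exists (bseqM (bseqV s) (bseqC (f n.+3))); first by rewrite -lim_ofM -lim_ofV.
  apply: hyperfilter_eventually; exists n.+3 => // j /= nj.
  rewrite asboolT//; apply: ball_embed.
    by apply: filtered_subgroupM => //; exact: filtered_subgroupV.
  rewrite embedM ?embedV//; last exact: filtered_subgroupV.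
  have [_ fj] := fP j; have [_ fn] := fP n.+3.
  have [h' [h1 h2]] := filter_ex (filterI fj fn).
  have -> : (embed (f j))^-1 * embed (f n.+3) =
      ((embed (f j))^-1 * h') * ((embed (f n.+3))^-1 * h')^-1.
    by rewrite invgM invgK mulgA mulgK.
  apply: lim_ballM; last exact: lim_ballV.
  exact: (lim_ball_le nj h1).
exists (lim_of s); split=> //.
apply: (@closed_cvg _ _ U _ id (closure (lim_ball 1))) => //.
exact: closed_closure.
Qed.

End LimitGroup.

Lemma locally_compact_of_nbhs (T : topologicalType) : hausdorff_space T ->
  (forall x : T, exists2 C, compact C & nbhs x C) -> locally_compact [set: T].
Proof.
move=> hT TC x _; have [C cC xC] := TC x; exists C.
  by apply: filterS xC => y Cy _.
by split=> //; exact: compact_closed.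
Qed.

(** * Cut-and-project schemes *)

(** The inverse of a chart carries a small closed ball, compact by finite dimension, onto a compact
    neighbourhood. *)
Lemma lie_group_locally_compact (R : realType) (G : topologicalGroupType) :
  lie_group R G -> locally_compact_group G.
Proof.
move=> [hG _ [n [A [[Achart Acover _] _ _]]]]; split=> //.
apply: locally_compact_of_nbhs => // x.
have [c Ac cx] := Acover x.
have [odom ocod cK cmap cinv] := Achart c Ac.
have codx : chart_cod c (chart_map c x) by exists x.
have /nbhs_closedballP[r rcod] : nbhs (chart_map c x) (chart_cod c).
  by apply: open_nbhs_nbhs.
exists (chart_inv c @` closed_ball (chart_map c x) r%:num).
  apply: continuous_compact.
    apply: continuous_in_subspaceT => v; rewrite inE => /rcod; exact: cinv.
  apply: bounded_closed_compact; last exact: closed_ball_closed.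
  rewrite closed_ballE//; exists (`|chart_map c x| + r%:num)%R; split.
    by rewrite realE addr_ge0.
  move=> M /ltW xM v /= xv; apply: le_trans xM.
  rewrite -[v](subrK (chart_map c x)) addrC (le_trans (ler_normD _ _))// lerD2l.
  by rewrite distrC.
have xdom : nbhs x (chart_dom c) by apply: open_nbhs_nbhs.
have xball : nbhs x (chart_map c @^-1` closed_ball (chart_map c x) r%:num).
  apply: (cmap x cx); apply/nbhs_closedballP; exists r => //.
apply: filterS2 xdom xball => y cy yr; exists (chart_map c y) => //.
exact: cK.
Qed.

(** Induction on the number of pieces. Near a point [q] of [Q] in the first piece, that piece
    reduces to [q]; the part of [Q] near [q] but without [q] avoids the piece, still has no isolated
    points, and is non-empty since [q] is a limit point. *)
Lemma finite_union_discrete_scattered (T : topologicalType) (I : eqType)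
    (s : seq I) (D : I -> set T) (Q : set T) : accessible_space T ->
  (forall i, i \in s -> forall x, D i x -> isolated (D i) x) ->
  (forall x, Q x -> exists2 i, i \in s & D i x) ->
  Q `<=` limit_point Q -> Q = set0.
Proof.
move=> T1; elim: s Q => [|i s IHs] Q Diso QD Qlim.
  by apply/seteqP; split=> // x /QD[].
have {}IHs Q' := IHs Q' (fun j js => Diso j (mem_behead (s := i :: s) js)).
have [Qi0|/set0P[q [Qq Diq]]] := eqVneq (Q `&` D i) set0.
  apply: IHs => // x Qx; have [j] := QD x Qx; rewrite inE => /predU1P[->|] Dx.
    by have : (Q `&` D i) x by []; rewrite Qi0.
  by exists j.
have [_ [V Vq VDi]] := Diso i (mem_head _ _) q Diq.
pose V' := (interior V) `\` [set q].
have V'nbhs x : V' x -> nbhs x V'.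
  move=> [Vx xq]; apply: filterI.
    by apply: open_nbhs_nbhs; split=> //; exact: open_interior.
  by apply: open_nbhs_nbhs; split=> //; exact/closed_openC/accessible_closed_set1.
suff QV0 : Q `&` V' = set0.
  have [|y [yq Qy Vy]] := Qlim q Qq (interior V); first exact: nbhs_interior.
  have : (Q `&` V') y by split=> //; split=> // /eqP; exact/negP.
  by rewrite QV0.
apply: IHs => [x [Qx [Vx xq]]|x [Qx V'x] U Ux].
  have [j] := QD x Qx; rewrite inE => /predU1P[->|js] Dx; last by exists j.
  have : (V `&` D i) x by split=> //; exact: interior_subset.
  by rewrite VDi.
have [|y [yx Qy [Uy V'y]]] := Qlim x Qx (U `&` V').
  by apply: filterI => //; exact: V'nbhs.
by exists y.
Qed.

(** * Discreteness of small balls *)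

Section TopologicalGroupFacts.
Variable G : topologicalGroupType.
Implicit Types (g x : G) (A : set G).

Lemma mulgl_continuous g : continuous (fun x : G => g * x).
Proof.
move=> x.
apply: (@cvg_comp _ _ _ (fun y => (g, y)) (fun p => p.1 * p.2) _ (nbhs (g, x))).
  by apply: cvg_pair; [exact: cvg_cst|exact: cvg_id].
exact: (@mulg_continuous G (g, x)).
Qed.

Lemma nbhs_ltranslate g x A : nbhs x A -> nbhs (g * x) (ltranslate g A).
Proof.
by move=> xA; have := @mulgl_continuous g^-1 (g * x) A; rewrite /= mulKg; exact.
Qed.

Lemma ltranslate_discrete g A :
  discrete_subset A -> discrete_subset (ltranslate g A).
Proof.
move=> Adisc x gAx; split; first exact: mem_set.
have [_ [V xV VA]] := Adisc _ gAx; exists (ltranslate g V).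
  by rewrite -[x](mulVKg g); exact: nbhs_ltranslate.
rewrite -ltranslateI VA; apply/seteqP; split=> [y /= gy|_ ->//].
exact: mulgI gy.
Qed.

Section DiscreteFiltration.
Variable Phi : filtration G.
Hypotheses (hG : hausdorff_space G) (Ldisc : discrete_subset (fgen Phi)).
Hypothesis LL : covered (set_mulg (fgen Phi) (fgen Phi)) (fgen Phi).

(* Otherwise every element of the increasing union of the products
   B_1 B_2 ... B_n, a subset of B_0, is a limit point of this union. *)
Lemma ball_isolated : exists n V, nbhs 1 V /\ V `&` fball Phi n `<=` [set 1].
Proof.
apply: contrapT => nV.
have near1 n V : nbhs 1 V -> exists2 y, y != 1 & V y /\ fball Phi n y.
  move=> V1; apply: contrapT => ny; apply: nV; exists n, V; split=> // y Vy.
  by apply: contrapT => /eqP y1; apply: ny; exists y.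
pose fix P n := if n is m.+1 then set_mulg (P m) (fball Phi n) else [set 1].
pose Q := \bigcup_n P n.
(* The product collapses from the right: the last factor and [y] merge into one element of the
   preceding ball. *)
have P0 n x y : P n x -> fball Phi n y -> fball Phi 0 (x * y).
  elim: n x y => [x y -> |n IHn _ y [x Px [z Bz <-]] By]; first by rewrite mul1g.
  by rewrite -mulgA; apply: IHn => //; exact: fballM.
have [F /finite_seqP[s ->] Fcov] := covered_expg 4 (fgen1 Phi) LL.
suff Q0 : Q = set0.
  have : Q 1 by exists 0%N.
  by rewrite Q0.
apply: (@finite_union_discrete_scattered _ _ s (fun f => ltranslate f (fgen Phi))).
- exact: hausdorff_accessible.
- by move=> f _; exact: ltranslate_discrete.
- move=> x [n _ Px].
  have := P0 n x 1 Px (fball1 _ _); rewrite mulg1 => /fball_sub/Fcov.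
  by move=> [f fs [y gy <-]]; exists f => //; rewrite /ltranslate /= mulKg.
move=> x [n _ Px] U xU.
have [|y y1 [Uy By]] := near1 n.+1 (ltranslate x^-1 U).
  by rewrite -(mulVg x); exact: nbhs_ltranslate.
exists (x * y); split.
- by rewrite -[X in _ != X]mulg1; apply: contra y1 => /eqP/mulgI ->.
- by exists n.+1 => //; exact: mem_set_mulg.
- by move: Uy; rewrite /ltranslate /= invgK.
Qed.

End DiscreteFiltration.
End TopologicalGroupFacts.

Lemma subgroup_lcoset (G : groupType) (A : set G) x a : subgroup A -> A a ->
  set_mulg [set x * a] A = set_mulg [set x] A.
Proof.
move=> As Aa; rewrite -!ltranslateE; apply/seteqP; split=> y; rewrite /ltranslate /=.
  by rewrite invgM -mulgA => /(subgroupM As Aa); rewrite mulVKg.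
by rewrite invgM -mulgA; apply: subgroupM => //; exact: subgroupV.
Qed.

(** * The graph of the canonical map as a uniform lattice *)

Section Scheme.
Variables (G : topologicalGroupType) (Phi : filtration G).
Hypotheses (hG : locally_compact_group G) (Ldisc : discrete_subset (fgen Phi)).
Hypothesis LL : covered (set_mulg (fgen Phi) (fgen Phi)) (fgen Phi).
Hypothesis Lco : compactly_commensurable (fgen Phi) [set: G].

Notation H := (limit_group Phi).
Notation Delta := (filtered_subgroup Phi).

Definition embed_graph : set (G * H) := [set p | Delta p.1 /\ p.2 = embed Phi p.1].

Lemma embed_graphP g : Delta g -> embed_graph (g, embed Phi g).
Proof. by []. Qed.

Lemma embed_graph_subgroup : subgroup embed_graph.
Proof.
split=> [|[g h] [g' h'] /set_mem[/= gD ->] /set_mem[/= gD' ->]]; apply/mem_set.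
  by split; [exact: filtered_subgroup1|rewrite /= embed1].
split; first by apply: filtered_subgroupM => //; exact: filtered_subgroupV.
by rewrite /= embedM ?embedV//; exact: filtered_subgroupV.
Qed.

Lemma embed_graph_discrete : discrete_subset embed_graph.
Proof.
move=> [g h] gh; split; first exact: mem_set.
have [gD /= ->] := gh.
have [n [V [V1 VB]]] := ball_isolated hG.1 Ldisc LL.
exists (ltranslate g V `*` ltranslate (embed Phi g) (lim_ball n.+1)).
  exists (ltranslate g V, ltranslate (embed Phi g) (lim_ball n.+1)) => //.
  split=> /=.
    by have := @nbhs_ltranslate _ g 1 V V1; rewrite mulg1.
  by exists n.+1 => u un; rewrite /ltranslate /= mulKg.
apply/seteqP; split=> [[g' h'] [[/= Vg' Bh'] [/= gD' hE]]|_ ->]; last first.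
  split; last exact: embed_graphP.
  rewrite /ltranslate /=; split; rewrite /= mulVg; first exact: nbhs_singleton.
  exact: lim_ball1.
suff gg' : g^-1 * g' = 1.
  by rewrite hE -(mulVKg g g') gg' mulg1.
apply: VB; split=> //; apply: ball_embed.
  by apply: filtered_subgroupM => //; exact: filtered_subgroupV.
rewrite embedM ?embedV//; last exact: filtered_subgroupV.
by move: Bh'; rewrite hE.
Qed.

Lemma embed_graph_cocompact : cocompact embed_graph.
Proof.
have [K [cK _ KL]] := Lco.
have [F [fF _ LF]] := @fball_cover _ Phi 1 2; rewrite set_expg1 in LF.
pose KF := [set x.1 * x.2 | x in K `*` F].
have cKF : compact KF.
  apply: continuous_compact; last first.
    by apply: compact_setX => //; exact: finite_compact.
  exact/continuous_subspaceT/mulg_continuous.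
have cC : compact (KF `*` closure (lim_ball (Phi := Phi) 1)).
  by apply: compact_setX => //; exact: compact_closure_lim_ball.
pose p : G * H -> coset_space embed_graph :=
  \pi_(quotient_topology {eq_quot lcoset_equiv embed_graph}).
have pC : compact (p @` (KF `*` closure (lim_ball (Phi := Phi) 1))).
  apply: continuous_compact => //; apply: continuous_subspaceT.
  exact: pi_continuous.
rewrite /cocompact (_ : setT = p @` (KF `*` closure (lim_ball (Phi := Phi) 1)))//.
apply/seteqP; split=> // q _.
have [[g h] <-] : exists x, p x = q by exists (repr q); exact: reprK.
(* Right multiplication by the graph point over [d * b^-1] brings [(g, h)] into the compact set: [d]
   makes the second coordinate small, then [g * d = k * f * b], and removing [b] changes that
   coordinate only by a small element. Two errors of index 2 give index 1. *)
have [d dD hd] := embed_dense h^-1 2.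
have [k Kk [l Ll kl]] := KL (g * d) I.
have [f Ff [b Bb fb]] := LF l Ll.
have bD : Delta b by exists 4%N; exact: fball_gen Bb.
have dVD := filtered_subgroupV dD.
exists (k * f, h * embed Phi d * (embed Phi b)^-1).
  split=> /=; first by exists (k, f).
  apply: subset_closure; apply: lim_ballM.
    by rewrite -[h * _]invgK invgM; exact: lim_ballV.
  by apply: lim_ballV; exact: embed_ball.
apply/eqmodP/asboolP.
rewrite -(@subgroup_lcoset _ _ _ (b * d^-1, embed Phi (b * d^-1))).
- congr (set_mulg [set _] _); congr (_, _).
    by rewrite /= mulgA -[k * f * b]mulgA fb kl mulgK.
  by rewrite /= embedM// embedV// !mulgA mulgVK mulgK.
- exact: embed_graph_subgroup.
- by apply: embed_graphP; exact: filtered_subgroupM.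
Qed.

Lemma embed_graph_scheme : cut_and_project_scheme embed_graph.
Proof.
split=> //.
- split; first exact: limit_group_hausdorff.
  apply: locally_compact_of_nbhs; first exact: limit_group_hausdorff.
  move=> h; exists [set h * u | u in closure (lim_ball (Phi := Phi) 1)].
    apply: continuous_compact; last exact: compact_closure_lim_ball.
    apply: continuous_subspaceT; exact: mulgl_continuous.
  by exists 1%N => u u1; exists u => //; exact: subset_closure.
- split; [exact: embed_graph_subgroup|exact: embed_graph_discrete|
    exact: embed_graph_cocompact].
- apply/seteqP; split=> [[g h] [[/= _ ->] [/= -> _]]|_ ->]; first by rewrite embed1.
  split; last by split.
  have := @filtered_subgroup1 _ Phi => /embed_graphP; rewrite embed1; exact.
- move=> O [h Oh] oO.
  have [n hn] : nbhs h O by apply: open_nbhs_nbhs.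
  have [g gD gh] := embed_dense h n.
  exists (embed Phi g); split; last by exists (g, embed Phi g).
  rewrite -(mulVKg h (embed Phi g)); apply: hn.
  by rewrite -[_ * _]invgK invgM invgK; exact: lim_ballV.
Qed.

(** Index 1 serves twice: the closure is compact, and [ball_embed] sends the model set into
    [fball Phi 0], hence into finitely many translates of [fgen Phi]. *)
Lemma lim_ball_window : window (lim_ball (Phi := Phi) 1).
Proof.
split.
- by exists 1%N => u; rewrite mul1g.
- apply/seteqP; split=> [u u1|_ [u u1 <-]]; last exact: lim_ballV.
  by exists u^-1; [exact: lim_ballV|rewrite invgK].
- by rewrite precompactE; exact: compact_closure_lim_ball.
Qed.

Lemma commensurable_model_set :
  commensurable (fgen Phi) (model_set embed_graph (lim_ball 1)).
Proof.
have [F [fF _ LF]] := @fball_cover _ Phi 1 1; rewrite set_expg1 in LF.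
have [F' fF' LF'] := covered_expg 4 (fgen1 Phi) LL.
exists (F `|` F'); split; first by rewrite finite_setU.
- apply: (subset_trans LF); apply: set_mulgSS; first exact: subsetUl.
  move=> b Bb; exists (b, embed Phi b) => //; split=> /=.
    by split=> //; exact: embed_ball.
  by apply: embed_graphP; exists 4%N; exact: fball_gen Bb.
- move=> _ [[g h] [[_ /= h1] [/= gD hE]] <-].
  have /fball_sub/LF' : fball Phi 0 g by apply: ball_embed => //; rewrite -hE.
  by apply: set_mulgSS => //; exact: subsetUr.
Qed.

End Scheme.

Lemma amenable_uniform_approximate_lattice_meyer (R : realType)
    (G : topologicalGroupType) (nu : set G -> R) (L : set G) :
  locally_compact_group G -> mean nu -> left_invariant setT nu ->
  uniform_approximate_lattice L -> meyer_subset L.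
Proof.
move=> hG nuM nuG [Lapp Ldisc Lco]; split=> //.
have [L1 LVE LL] := Lapp.
have LV : inv_closed L by move=> x Lx; rewrite LVE; exists x.
have [Phi PhiL] := filtration_exists nuM nuG L1 LV LL.
rewrite -PhiL in Ldisc Lco LL *.
exists (limit_group Phi), (@embed_graph G Phi), (lim_ball 1); split.
- exact: embed_graph_scheme.
- exact: lim_ball_window.
- exact: commensurable_model_set.
Qed.

Theorem theorem2 (R : realType) (G : topologicalGroupType) (Lambda : set G)
    (hLie : lie_group R G) (hconn : connected [set: G]) (hsol : soluble G)
    (hLambda : uniform_approximate_lattice Lambda) :
  meyer_subset Lambda.
Proof.
have [nu nuM nuG] := soluble_invariant_mean R hsol.
apply: (amenable_uniform_approximate_lattice_meyer _ nuM nuG) => //.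
exact: lie_group_locally_compact hLie.
Qed.
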